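(* Under $\widetilde P_1^{(2,\log)}$, the winding process $(\theta_t)_{t\ge0}=(\alpha_{H_t})_{t\ge0}$ satisfies: 1) $\displaystyle\frac{4}{(\log t)^2}\,H_t\xrightarrow[t\to\infty]{(\mathrm{law})}T_1^{(3)}$, where $T_1^{(3)}=\inf\{u:\rho_u=1\}$ is the first hitting time of level $1$ by a 3-dimensional Bessel process $(\rho_u)_{u\ge0}$ started at $0$. 2) $\displaystyle\frac{2}{\log t}\,\theta_t\xrightarrow[t\to\infty]{(\mathrm{law})}\alpha_{T_1^{(3)}}$, where in the limit $(\alpha_u)_{u\ge0}$ is a 1-dimensional Brownian motion started at $0$, independent of $(\rho_u)_{u\ge0}$.
   Context: $(R_t)_{t\ge0}$ is the solution, starting from $1$ and with $R_t>1$ for all $t>0$ a.s., of $$R_t=1+\beta_t+\int_0^t\frac{ds}{R_s}\left(\frac12+\frac1{\log R_s}\right),$$ where $(\beta_t)_{t\ge0}$ is a 1-dimensional Brownian motion started at $0$. Equivalently $(\log R_t)_{t\ge0}=(\rho_{H_t})_{t\ge0}$ with $(\rho_u)_{u\ge0}$ a 3-dimensional Bessel process started at $0$ and $$H_t=\int_0^t\frac{ds}{R_s^2}.$$ $(\alpha_u)_{u\ge0}$ is a 1-dimensional Brownian motion with initial value $\alpha_0$, the increments $(\alpha_u-\alpha_0)_{u\ge0}$ and $\alpha_0$ being independent of $(R_t)_{t\ge0}$. $\widetilde P_1^{(2,\log)}$ is the law of the $\mathbb C$-valued process $(R_te^{i\alpha_{H_t}})_{t\ge0}$, which starts on the unit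 circle at $e^{i\alpha_0}$; its winding process is $\theta_t=\alpha_{H_t}$. *)

(* Defs.v *)
(* MathComp-Analysis development over an abstract [R : realType]. *)
From HB Require Import structures.
From mathcomp Require Import all_boot all_order all_algebra.
From mathcomp Require Import all_classical all_reals all_analysis.
Set Implicit Arguments.
Unset Strict Implicit.
Unset Printing Implicit Defensive.
Import Order.TTheory GRing.Theory Num.Theory.
Import numFieldNormedType.Exports.

Local Open Scope classical_set_scope.
Local Open Scope ring_scope.

(* A real process is a family [X : R -> {RV P >-> R}] of random variables; only
   the times t >= 0 are meaningful, and every definition below looks at those
   times only. *)

Definition continuous_paths d (T : measurableType d) (R : realType)
    (P : probability T R) (X : R -> {RV P >-> R}) : Prop :=
  forall w : T, {within `[0, +oo[%classic, continuous (fun t : R => X t w)}.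

(* sigma(X_t, t in I) *)
Definition sigma_process d (T : measurableType d) (R : realType)
    (P : probability T R) (X : R -> {RV P >-> R}) (I : set R) : set (set T) :=
  <<s \bigcup_(t in I) preimage_set_system setT (X t) measurable >>.

Definition independent_systems d (T : measurableType d) (R : realType)
    (P : probability T R) (F G : set (set T)) : Prop :=
  forall A B, F A -> G B -> P (A `&` B) = (P A * P B)%E.

Definition independent_processes d (T : measurableType d) (R : realType)
    (P : probability T R) (X Y : R -> {RV P >-> R}) : Prop :=
  independent_systems P (sigma_process X `[0, +oo[%classic)
                        (sigma_process Y `[0, +oo[%classic).

(* One-dimensional Brownian motion with an arbitrary random initial value.  The
   increments after s are independent of the whole past up to s, hence (s = 0)
   also of the initial value.  [normal_prob] takes the standard deviation. *)
Definition brownian_motion d (T : measurableType d) (R : realType)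
    (P : probability T R) (B : R -> {RV P >-> R}) : Prop :=
  [/\ continuous_paths B,
      forall s t : R, 0 <= s -> s < t -> forall A : set R, measurable A ->
        P ((fun w => B t w - B s w) @^-1` A) =
        normal_prob 0 (Num.sqrt (t - s)) A
    & forall s t : R, 0 <= s -> s < t ->
        independent_systems P (sigma_process B `[0, s]%classic)
          (preimage_set_system setT (fun w => B t w - B s w) measurable)].

Definition brownian_motion0 d (T : measurableType d) (R : realType)
    (P : probability T R) (B : R -> {RV P >-> R}) : Prop :=
  brownian_motion B /\ {ae P, forall w, B 0 w = 0}.

Definition brownian_motion3 d (T : measurableType d) (R : realType)
    (P : probability T R) (B : 'I_3 -> R -> {RV P >-> R}) : Prop :=
  (forall i, brownian_motion0 (B i)) /\
  (forall A : 'I_3 -> set T,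
     (forall i, sigma_process (B i) `[0, +oo[%classic (A i)) ->
     P (\bigcap_i A i) = (\prod_(i < 3) P (A i))%E).

(* Three-dimensional Bessel process started at 0: a continuous process with the
   law of the Euclidean norm of a three-dimensional Brownian motion started at
   0.  That Brownian motion may live on another probability space; the laws are
   compared through their finite-dimensional marginals. *)
Definition bessel3 d (T : measurableType d) (R : realType)
    (P : probability T R) (rho : R -> {RV P >-> R}) : Prop :=
  continuous_paths rho /\
  exists (d' : measure_display) (W : measurableType d') (Q : probability W R)
         (B : 'I_3 -> R -> {RV Q >-> R}),
    brownian_motion3 B /\
    forall (n : nat) (t : 'I_n -> R) (A : 'I_n -> set R),
      (forall i, 0 <= t i) -> (forall i, measurable (A i)) ->
      P [set w | forall i, A i (rho (t i) w)] =
      Q [set w | forall i, A i (Num.sqrt (\sum_(k < 3) B k (t i) w ^+ 2))].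

(* H_t = \int_0^t ds / (R_s)^2 *)
Definition clock d (T : measurableType d) (R : realType)
    (P : probability T R) (Rt : R -> {RV P >-> R}) (t : R) (w : T) : R :=
  \int[lebesgue_measure]_(s in `[0, t]) (Rt s w ^+ 2)^-1.

(* Since R > 1 on ]0, +oo[, the drift is nonnegative there, and an equality of
   extended reals also says that the drift integral is finite.  Taking t = 0
   gives R_0 = 1 almost surely.  The noise being additive, no stochastic
   integral is involved. *)
Definition radial_SDE d (T : measurableType d) (R : realType)
    (P : probability T R) (beta Rt : R -> {RV P >-> R}) : Prop :=
  [/\ brownian_motion0 beta,
      continuous_paths Rt,
      {ae P, forall w, forall t : R, 0 < t -> 1 < Rt t w}
    & {ae P, forall w, forall t : R, 0 <= t ->
        (Rt t w)%:E = ((1 + beta t w)%:E +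
          \int[lebesgue_measure]_(s in `[0%R, t])
             ((Rt s w)^-1 * (2^-1 + (ln (Rt s w))^-1))%:E)%E}].

Definition log_time_change d (T : measurableType d) (R : realType)
    (P : probability T R) (rho Rt : R -> {RV P >-> R}) : Prop :=
  bessel3 rho /\
  {ae P, forall w, forall t : R, 0 <= t -> ln (Rt t w) = rho (clock Rt t w) w}.

(* theta_t = alpha_{H_t} *)
Definition winding d (T : measurableType d) (R : realType)
    (P : probability T R) (alpha Rt : R -> {RV P >-> R}) (t : R) (w : T) : R :=
  alpha (clock Rt t w) w.

(* inf {u >= 0 : X_u = a}.  The infimum is taken in R, so it is 0 when the level
   is never reached, which is a null event for a Bessel process started at 0 and
   a level a > 0. *)
Definition hitting_time d (T : measurableType d) (R : realType)
    (P : probability T R) (X : R -> {RV P >-> R}) (a : R) (w : T) : R :=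
  inf [set u : R | 0 <= u /\ X u w = a].

(* Convergence in law of X_t to Y as t -> +oo.  Measurability is part of the
   claim, so that the expectations are those of genuine random variables. *)
Definition cvg_in_law d (T : measurableType d) d' (T' : measurableType d')
    (R : realType) (P : probability T R) (P' : probability T' R)
    (X : R -> T -> R) (Y : T' -> R) : Prop :=
  [/\ forall t : R, measurable_fun setT (X t),
      measurable_fun setT Y
    & forall f : R -> R, continuous f ->
        (exists M : R, forall x : R, `|f x| <= M) ->
        (\int[P]_w f (X t w)) @[t --> +oo] --> \int[P']_w f (Y w)].

(* Main.v *)
Require Import Defs.
From HB Require Import structures.
From mathcomp Require Import all_boot all_order all_algebra.
From mathcomp Require Import all_classical all_reals all_analysis.
From mathcomp Require Import measurable_realfun ring lra.
Set Implicit Arguments.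
Unset Strict Implicit.
Unset Printing Implicit Defensive.
Import Order.TTheory GRing.Theory Num.Theory.
Import numFieldNormedType.Exports.

Local Open Scope classical_set_scope.
Local Open Scope ring_scope.

(** Put lam = (log t) / 2.  Since log R_s = rho (H_s) and dH_s = ds / R_s^2,
    the additive functional A_u = int_0^u exp (2 rho_s) ds satisfies
    A (H_t) = t: the clock H is the inverse of A, and H_t > u iff A_u < t
    ([clock_lt]).  By Bessel scaling, A at time lam^2 v has the law of
    lam^2 int_0^v exp (2 lam rho'_s) ds for every Bessel process rho' started
    at 0.  Hence H_t / lam^2 has the law of the time Phi_lam at which
    lam^2 int_0^v exp (2 lam rho'_s) ds reaches t = exp (2 lam)
    ([clock_coupling]).  This time is a functional of rho' alone, and by
    Laplace's principle it converges almost surely: for large lam the integral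
    is governed by exp (2 lam max rho'), so that it stays below exp (2 lam)
    while the running maximum of rho' is below 1 and exceeds it as soon as the
    running maximum passes 1 ([inverse_functional_cvg]).  The limit is therefore
    the hitting time T of level 1, provided that the running maximum does not
    rest at 1 after T; scaling excludes such a plateau, because the running
    maximum at time 1 has at most countably many atoms ([bessel_no_flat]).
    Dominated convergence then yields the first claim.

    A Bessel process is only given through its finite-dimensional laws, by
    means of a Brownian motion on some other space.  On a regular grid these
    laws are determined by the Gaussian increments ([brownian_grid_unique],
    [bessel_grid_unique]), and integrals and running maxima of continuous paths
    are limits of functions of the values on finer and finer grids
    ([bessel_functional_law]).  This is how laws are compared across spaces.

    For the winding, independence allows to freeze the time:
    E f (theta_t / lam) = E psi (H_t), where psi u = E f (alpha_u / lam)
    ([expectation_independent_time]).  Brownian scaling turns psi (lam^2 h) into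
    the expectation of f (alpha_0 / lam + alpha'_h), where alpha' is a Brownian
    motion started at 0 and independent of alpha_0
    ([expectation_brownian_split]).  The starting point is washed out as lam
    grows, so that along the same Phi_lam these expectations converge to
    E f (alpha'_h) at h = T, and freezing the time backwards for alpha' and T
    gives E f (alpha'_T). *)

(** * Equality in law *)

Definition same_law d (T : measurableType d) d' (T' : measurableType d')
    (R : realType) (P : probability T R) (P' : probability T' R)
    d0 (E : measurableType d0) (X : T -> E) (Y : T' -> E) : Prop :=
  forall A, measurable A -> P (X @^-1` A) = P' (Y @^-1` A).

Definition mfun_of d (T : measurableType d) d' (T' : measurableType d')
    (f : T -> T') (mf : measurable_fun setT f) : {mfun T >-> T'} :=
  HB.pack f (isMeasurableFun.Build _ _ _ _ _ mf).

Lemma measurable_preimage d (T : measurableType d) d' (T' : measurableType d')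
    (f : T -> T') (A : set T') :
  measurable_fun setT f -> measurable A -> measurable (f @^-1` A).
Proof. by move=> mf mA; rewrite -[X in measurable X]setTI; exact: mf. Qed.

Lemma measurable_lt d (T : measurableType d) (R : realType) (f : T -> R) (c : R) :
  measurable_fun setT f -> measurable [set w | f w < c].
Proof.
move=> mf; have := measurable_preimage mf (measurable_itv `]-oo, c[).
by congr measurable; apply/seteqP; split=> w /=; rewrite in_itv.
Qed.

Lemma measurable_gt d (T : measurableType d) (R : realType) (f : T -> R) (c : R) :
  measurable_fun setT f -> measurable [set w | c < f w].
Proof.
move=> mf; have := measurable_preimage mf (measurable_itv `]c, +oo[).
by congr measurable; apply/seteqP; split=> w /=; rewrite in_itv/= andbT.
Qed.

Lemma measurable_fun_lt d (T : measurableType d) (R : realType) (f : T -> R) :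
  (forall c, measurable [set w | f w < c]) -> measurable_fun setT f.
Proof.
move=> mf mD; apply: (measurability _ (RGenInftyO.measurableE R)) => //.
move=> _ [_ [c ->] <-]; rewrite setTI; have := mf c.
by congr measurable; apply/seteqP; split=> w /=; rewrite in_itv.
Qed.

Lemma measurable_fun_gt d (T : measurableType d) (R : realType) (f : T -> R) :
  (forall w, 0 <= f w) ->
  (forall c, 0 <= c -> measurable [set w | c < f w]) -> measurable_fun setT f.
Proof.
move=> f0 mf mD; apply: (measurability _ (RGenOInfty.measurableE R)) => //.
move=> _ [_ [c ->] <-]; rewrite setTI.
rewrite (_ : _ @^-1` _ = [set w | c < f w]); last first.
  by apply/seteqP; split=> w /=; rewrite in_itv/= andbT.
have [c0|c0] := leP 0 c; first exact: mf.
rewrite (_ : [set w | _] = setT)//; apply/seteqP; split=> // w _ /=.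
exact: lt_le_trans (f0 w).
Qed.

Lemma same_law_comp d (T : measurableType d) d' (T' : measurableType d')
    (R : realType) (P : probability T R) (P' : probability T' R)
    d0 (E : measurableType d0) d1 (E' : measurableType d1)
    (X : T -> E) (Y : T' -> E) (f : E -> E') :
  measurable_fun setT f -> same_law P P' X Y ->
  same_law P P' (f \o X) (f \o Y).
Proof.
by move=> mf XY A mA; apply: (XY (f @^-1` A)); exact: measurable_preimage.
Qed.

Section bounded.
Context d (T : measurableType d) (R : realType) (P : probability T R).

Lemma bounded_integrable (f : T -> R) (M : R) : measurable_fun setT f ->
  (forall w, `|f w| <= M) -> P.-integrable setT (EFin \o f).
Proof.
move=> mf fM; apply: (@le_integrable _ _ _ P setT measurableT _ (EFin \o cst M)).
- exact/measurable_EFinP.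
- move=> x _ /=; rewrite lee_fin; apply: le_trans (fM x) _; exact: ler_norm.
- exact: finite_measure_integrable_cst.
Qed.

Lemma Rintegral_bounded (f : T -> R) (M : R) : measurable_fun setT f ->
  (forall w, `|f w| <= M) -> `|\int[P]_w f w| <= M.
Proof.
move=> mf fM; have If := bounded_integrable mf fM.
apply: (le_trans (le_normr_Rintegral measurableT If)).
apply: (@le_trans _ _ (\int[P]_w M)); last first.
  have P1 : fine (P setT) = 1 by rewrite probability_setT.
  by rewrite Rintegral_cst// P1 mulr1.
apply: le_Rintegral => //.
  apply: (@bounded_integrable (fun w => `|f w|) M).
    exact: measurableT_comp.
  by move=> w; rewrite normr_id.
exact: finite_measure_integrable_cst.
Qed.

Lemma bounded_cvg (f_ : nat -> T -> R) (f : T -> R) (M : R) :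
  (forall n, measurable_fun setT (f_ n)) -> measurable_fun setT f ->
  (forall n w, `|f_ n w| <= M) ->
  {ae P, forall w, f_ n w @[n --> \oo] --> f w} ->
  \int[P]_w f_ n w @[n --> \oo] --> \int[P]_w f w.
Proof.
move=> mf_ mf fM cf.
have := @dominated_convergence _ T R P setT measurableT
  (fun n => EFin \o f_ n) (EFin \o f) (EFin \o cst M).
case.
- by move=> n; exact/measurable_EFinP.
- exact/measurable_EFinP.
- by apply: filterS cf => w cw _; apply/cvg_EFin => //; exact: nearW.
- exact: finite_measure_integrable_cst.
- by apply: aeW => w n _ /=; rewrite lee_fin.
move=> intf _ cv; rewrite /Rintegral.
apply: fine_cvg; rewrite fineK//; exact: integrable_fin_num.
Qed.

Lemma Rintegral_indic_lt (X : T -> R) (c : R) : measurable_fun setT X ->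
  \int[P]_w (\1_`]-oo, c[ (X w) : R) = fine (P [set w | X w < c]).
Proof.
move=> mX; rewrite /Rintegral; congr fine.
rewrite (_ : (fun w => _) = (EFin \o \1_[set w | X w < c])).
  by rewrite integral_indic ?setIT//; exact: measurable_lt.
apply/funext => w/=; rewrite !indicE; congr (_%:R%:E).
Qed.

End bounded.

Section same_law_theory.
Context d (T : measurableType d) d' (T' : measurableType d')
    (R : realType) (P : probability T R) (P' : probability T' R).

Lemma same_law_int d0 (E : measurableType d0) (X : T -> E) (Y : T' -> E)
    (f : E -> R) (M : R) :
  measurable_fun setT X -> measurable_fun setT Y -> measurable_fun setT f ->
  (forall x, `|f x| <= M) -> same_law P P' X Y ->
  \int[P]_w f (X w) = \int[P']_w f (Y w).
Proof.
move=> mX mY mf fM XY; rewrite /Rintegral; congr fine.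
have e1 := @integral_pushforward _ _ _ _ _ X mX P setT (EFin \o f).
have e2 := @integral_pushforward _ _ _ _ _ Y mY P' setT (EFin \o f).
rewrite !preimage_setT in e1 e2.
transitivity (\int[pushforward P X]_x (f x)%:E)%E.
  rewrite e1//; first exact/measurable_EFinP.
  by apply: (@bounded_integrable _ _ _ P (f \o X) M) => [|w]; [exact: measurableT_comp|exact: fM].
transitivity (\int[pushforward P' Y]_x (f x)%:E)%E; last first.
  rewrite e2//; first exact/measurable_EFinP.
  by apply: (@bounded_integrable _ _ _ P' (f \o Y) M) => [|w]; [exact: measurableT_comp|exact: fM].
apply: (@eq_measure_integral _ _ _ _ _ (distribution P (mfun_of mX))).
by move=> A mA _; exact: XY.
Qed.

Lemma same_law_lt (X : T -> R) (Y : T' -> R) :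
  measurable_fun setT X -> measurable_fun setT Y ->
  (forall c, P [set w | X w < c] = P' [set w | Y w < c]) -> same_law P P' X Y.
Proof.
move=> mX mY XY A mA.
have -> : P (X @^-1` A) = distribution P (mfun_of mX) A by [].
have -> : P' (Y @^-1` A) = distribution P' (mfun_of mY) A by [].
apply: (@measure_unique _ R _ (@RGenInftyO.G R) (fun n => `]-oo, n%:R[%classic)
  _ _ _ _ (distribution P (mfun_of mX)) (distribution P' (mfun_of mY))).
- exact: RGenInftyO.measurableE.
- move=> _ _ [a ->] [b ->]; exists (Num.min a b).
  apply/seteqP; split=> x /=; rewrite !in_itv/= lt_min; first by case=> -> ->.
  by case/andP.
- by move=> i; exists i%:R.
- apply/seteqP; split=> // x _; exists (Num.truncn `|x|).+1 => //=.
  by rewrite in_itv/= (le_lt_trans (ler_norm x))// truncnS_gt.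
- move=> _ [c ->]; rewrite /distribution /pushforward /=.
  by have := XY c; congr (P _ = P' _); apply/seteqP; split=> w /=; rewrite in_itv.
- by move=> k; rewrite (le_lt_trans (probability_le1 _ _))// ?ltry.
- by [].
Qed.

(** Continuous functions increasing to the indicator of ]-oo, c[. *)
Let ramp (c : R) (n : nat) (x : R) : R :=
  Num.min 1 (n%:R * Num.max (c - x) 0).

Let ramp_bounded c n x : `|ramp c n x| <= 1.
Proof.
rewrite /ramp ger0_norm ?ge_min ?lexx// le_min ler01/= mulr_ge0//.
by rewrite le_max lexx orbT.
Qed.

Let ramp_cont c n : continuous (ramp c n).
Proof.
move=> x.
apply: (@continuous_min R R (cst 1) (fun x => n%:R * Num.max (c - x) 0)).
  exact: cvg_cst.
apply: continuousM; first exact: cvg_cst.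
apply: (@continuous_max R R (fun x => c - x) (cst 0)); last exact: cvg_cst.
by apply: continuousB; [exact: cvg_cst|exact: cvg_id].
Qed.

Let ramp_cvg c x : ramp c n x @[n --> \oo] --> (\1_`]-oo, c[ x : R).
Proof.
rewrite /ramp indicE; have [xc|cx] := ltP x c.
  rewrite mem_set/= ?in_itv//=; apply: cvg_near_cst; near=> n.
  rewrite (max_idPl _); last by rewrite subr_ge0 ltW.
  apply/min_idPl; rewrite -ler_pdivrMr ?subr_gt0//.
  by near: n; exact: nbhs_infty_ger.
rewrite memNset/= ?in_itv/=; last by rewrite ltNge cx.
apply: cvg_near_cst; apply: nearW => n.
by rewrite (max_idPr _) ?mulr0 ?subr_le0//; apply/min_idPr.
Unshelve. all: by end_near. Qed.

(** Expectations of bounded continuous functions pass to pointwise limits by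
    dominated convergence, and the functions [ramp] recover the distribution
    function from them. *)
Lemma same_law_cvg (X_ : nat -> T -> R) (Y_ : nat -> T' -> R)
    (X : T -> R) (Y : T' -> R) :
  (forall n, measurable_fun setT (X_ n)) ->
  (forall n, measurable_fun setT (Y_ n)) ->
  (forall w, X_ n w @[n --> \oo] --> X w) ->
  (forall w, Y_ n w @[n --> \oo] --> Y w) ->
  (forall n, same_law P P' (X_ n) (Y_ n)) -> same_law P P' X Y.
Proof.
move=> mX_ mY_ cX cY XY.
have mX : measurable_fun setT X by exact: (measurable_fun_cvg mX_).
have mY : measurable_fun setT Y by exact: (measurable_fun_cvg mY_).
have mr c k : measurable_fun setT (ramp c k).
  by apply: continuous_measurable_fun; exact: ramp_cont.
have E c k : \int[P]_w ramp c k (X w) = \int[P']_w ramp c k (Y w).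
  have h1 : \int[P]_w ramp c k (X_ n w) @[n --> \oo] --> \int[P]_w ramp c k (X w).
    apply: (@bounded_cvg _ _ _ _ _ _ 1) => //.
    - by move=> n; exact: measurableT_comp.
    - exact: measurableT_comp.
    - by apply: aeW => w; apply: continuous_cvg; [exact: ramp_cont|exact: cX].
  have h2 : \int[P']_w ramp c k (Y_ n w) @[n --> \oo] --> \int[P']_w ramp c k (Y w).
    apply: (@bounded_cvg _ _ _ _ _ _ 1) => //.
    - by move=> n; exact: measurableT_comp.
    - exact: measurableT_comp.
    - by apply: aeW => w; apply: continuous_cvg; [exact: ramp_cont|exact: cY].
  have h3 : (fun n => \int[P]_w ramp c k (X_ n w)) =
            (fun n => \int[P']_w ramp c k (Y_ n w)).
    by apply/funext => n; exact: (@same_law_int _ _ _ _ _ 1).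
  rewrite h3 in h1; exact: (cvg_unique _ h1 h2).
apply: same_law_lt => // c.
have h1 : \int[P]_w ramp c k (X w) @[k --> \oo] -->
    \int[P]_w (\1_`]-oo, c[ (X w) : R).
  apply: (@bounded_cvg _ _ _ _ _ _ 1) => //.
  - by move=> n; exact: measurableT_comp.
  - by apply: measurableT_comp.
  - by apply: aeW => w; exact: ramp_cvg.
have h2 : \int[P']_w ramp c k (Y w) @[k --> \oo] -->
    \int[P']_w (\1_`]-oo, c[ (Y w) : R).
  apply: (@bounded_cvg _ _ _ _ _ _ 1) => //.
  - by move=> n; exact: measurableT_comp.
  - by apply: measurableT_comp.
  - by apply: aeW => w; exact: ramp_cvg.
have h3 : (fun k => \int[P]_w ramp c k (X w)) =
          (fun k => \int[P']_w ramp c k (Y w)) by apply/funext.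
rewrite h3 in h1; have e := cvg_unique _ h1 h2.
have f1 : P [set w | X w < c] \is a fin_num.
  by apply: fin_num_measure; exact: measurable_lt.
have f2 : P' [set w | Y w < c] \is a fin_num.
  by apply: fin_num_measure; exact: measurable_lt.
rewrite !Rintegral_indic_lt// in e.
by rewrite -(fineK f1) -(fineK f2) e.
Qed.

End same_law_theory.

Lemma same_law_gt d (T : measurableType d) d' (T' : measurableType d')
    (R : realType) (P : probability T R) (P' : probability T' R)
    (X : T -> R) (Y : T' -> R) :
  measurable_fun setT X -> measurable_fun setT Y ->
  (forall c, P [set w | c < X w] = P' [set w | c < Y w]) -> same_law P P' X Y.
Proof.
move=> mX mY XY.
have sl : same_law P P' (fun w => - X w) (fun w => - Y w).
  apply: same_law_lt; [exact: measurableT_comp|exact: measurableT_comp|] => c.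
  have -> : [set w | - X w < c] = [set w | - c < X w].
    by apply/seteqP; split=> w /=; rewrite ltrNl.
  have -> : [set w | - Y w < c] = [set w | - c < Y w].
    by apply/seteqP; split=> w /=; rewrite ltrNl.
  exact: XY.
have mN : measurable_fun setT (fun x : R => - x).
  by apply: continuous_measurable_fun; exact: opp_continuous.
move=> A mA; have := same_law_comp mN sl mA.
by congr (P _ = P' _); apply/seteqP; split=> w /=; rewrite opprK.
Qed.

(** * Almost sure and deterministic events *)

Section almost_sure.
Context d (T : measurableType d) (R : realType) (P : probability T R).

Lemma ae_forall_nat (A : nat -> set T) :
  (forall n, {ae P, forall w, A n w}) -> {ae P, forall w, forall n, A n w}.
Proof.
move=> Aae; have /negligibleS : P.-negligible (\bigcup_n ~` A n).
  by apply: negligible_bigcup => n; exact: Aae.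
by apply => w /= /existsNP[n nA]; exists n.
Qed.

Lemma ae_probability1 (A : set T) : measurable A -> P A = 1%E ->
  {ae P, forall w, A w}.
Proof.
move=> mA PA; exists (~` A); split => //; first exact: measurableC.
by rewrite probability_setC// PA subee.
Qed.

Lemma ae_probability0 (A : set T) : measurable A -> P A = 0%E ->
  {ae P, forall w, ~ A w}.
Proof. by move=> mA PA; exists A; split => // w /= /contrapT. Qed.

End almost_sure.

(** Modifying an event on a null set does not change its probability, even if
    the null set is only known to be covered by a measurable one. *)
Lemma ae_eq_probability d (T : measurableType d) (R : realType)
    (P : probability T R) (A B : set T) : measurable A -> measurable B ->
  {ae P, forall w, A w <-> B w} -> P A = P B.
Proof.
move=> mA mB [N [mN PN sN]].
have h (C D : set T) : measurable C -> measurable D ->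
    (forall w, ~ N w -> C w -> D w) -> (P C <= P D)%E.
  move=> mC mD CD; rewrite -[leRHS]adde0 -PN.
  apply: le_trans (measureU2 _ mD mN).
  apply: le_measure; rewrite ?inE//; first exact: measurableU.
  by move=> w Cw; have [Nw|Nw] := pselect (N w); [right|left; exact: CD].
apply/eqP; rewrite eq_le; apply/andP; split; apply: h => // w Nw; apply: contrapT.
  move=> hn; apply: Nw; apply: sN => /= hAB; apply: hn; exact: (hAB.1).
move=> hn; apply: Nw; apply: sN => /= hAB; apply: hn; exact: (hAB.2).
Qed.

(** Events that do not depend on the sample point: they arise from Brownian
    motion over an interval of length 0, whose increment is constant. *)
Lemma cst_event (T : Type) (S : Prop) :
  ([set _ : T | S] = setT) \/ ([set _ : T | S] = set0).
Proof.
by have [S1|S0] := pselect S; [left|right]; apply/seteqP; split=> // w /=.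
Qed.

Section cst_event.
Context d (T : measurableType d) (R : realType) (P : probability T R) (S : Prop).

Lemma measurable_cst_event : measurable [set _ : T | S].
Proof. by case: (cst_event T S) => ->. Qed.

Lemma independent_cst_event (B : set T) :
  P (B `&` [set _ | S]) = (P B * P [set _ : T | S])%E.
Proof.
case: (cst_event T S) => ->; first by rewrite setIT probability_setT mule1.
by rewrite setI0 measure0 mule0.
Qed.

End cst_event.

Lemma probability_cst_event d (T : measurableType d) d' (T' : measurableType d')
    (R : realType) (P : probability T R) (P' : probability T' R) (S : Prop) :
  P [set _ | S] = P' [set _ | S].
Proof.
have [S1|S0] := pselect S.
  have e T0 : [set _ : T0 | S] = setT by apply/seteqP; split.
  by rewrite (e T) (e T') !probability_setT.
have e T0 : [set _ : T0 | S] = set0 by apply/seteqP; split.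
by rewrite (e T) (e T') !measure0.
Qed.

(** * Laws of finite families *)

Definition boxes (I : Type) (R : realType) : set (set (I -> R)) :=
  [set S | exists2 A : I -> set R,
     (forall i, measurable (A i)) & S = [set x | forall i, A i (x i)]].

(** For finite [I] this is the product sigma-algebra. *)
Definition path_space (I : Type) (R : realType) :=
  g_sigma_algebraType (@boxes I R).

Section path_space.
Context (I : finType) (R : realType).

Lemma measurable_coord (i : I) :
  measurable_fun setT (fun x : path_space I R => x i).
Proof.
move=> _ A mA; rewrite setTI; apply: sub_sigma_algebra.
exists (fun j => if j == i then A else setT) => [j|]; first by case: ifP.
apply/seteqP; split=> x /=; last by move=> /(_ i); rewrite eqxx.
by move=> Axi j; case: eqP => // ->.
Qed.

Lemma measurable_box d (T : measurableType d) (X : T -> I -> R) (A : I -> set R) :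
  (forall i, measurable_fun setT (X ^~ i)) -> (forall i, measurable (A i)) ->
  measurable [set w | forall i, A i (X w i)].
Proof.
move=> mX mA.
rewrite (_ : [set w | _] = \bigcap_(i in [set: I]) (X ^~ i) @^-1` (A i)).
  apply: fin_bigcap_measurable => // i _.
  exact: measurable_preimage.
by apply/seteqP; split=> w /= h i; [move=> _; exact: h|exact: (h i)].
Qed.

Lemma measurable_path d (T : measurableType d) (X : T -> path_space I R) :
  (forall i, measurable_fun setT (fun w => X w i)) -> measurable_fun setT X.
Proof.
move=> mX; apply: (@measurability _ _ T (path_space I R) setT X (@boxes I R)) => //.
move=> _ [_ [A mA ->] <-]; rewrite setTI.
exact: measurable_box.
Qed.

(** Boxes are stable under intersection and generate the product sigma-algebra,
    so that Dynkin's lemma applies. *)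
Lemma same_law_box d (T : measurableType d) d' (T' : measurableType d')
    (P : probability T R) (P' : probability T' R)
    (X : T -> path_space I R) (Y : T' -> path_space I R) :
  (forall i, measurable_fun setT (fun w => X w i)) ->
  (forall i, measurable_fun setT (fun w => Y w i)) ->
  (forall A : I -> set R, (forall i, measurable (A i)) ->
    P [set w | forall i, A i (X w i)] = P' [set w | forall i, A i (Y w i)]) ->
  same_law P P' X Y.
Proof.
move=> mX mY XY A mA.
have mX' := measurable_path mX; have mY' := measurable_path mY.
apply: (@measure_unique _ R (path_space I R) (@boxes I R) (fun=> setT)
  _ _ _ _ (distribution P (mfun_of mX')) (distribution P' (mfun_of mY'))) => //.
- move=> _ _ [B mB ->] [C mC ->]; exists (fun i => B i `&` C i).
    by move=> i; exact: measurableI.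
  apply/seteqP; split=> x /=; first by case=> Bx Cx i; split.
  by move=> h; split=> i; have [] := h i.
- move=> _; exists (fun=> setT) => //.
  by apply/seteqP; split.
- by rewrite bigcup_const//; exists 0%N.
- move=> _ [B mB ->]; exact: XY.
- by move=> _; rewrite (le_lt_trans (probability_le1 _ _))// ltry.
Qed.

End path_space.

(** * Processes and their sigma-algebras *)

(** The sample space with the smaller sigma-algebra generated by a process:
    measurability with respect to the process becomes measurability of a
    function on this type. *)
Local Notation sigma_type X I := (g_sigma_algebraType
  (\bigcup_(t in I) preimage_set_system setT (X t) measurable)).
Local Notation history X := (sigma_type X `[0, +oo[%classic).

Lemma sigma_process_measurable d (T : measurableType d) (R : realType)
    (P : probability T R) (X : R -> {RV P >-> R}) (I : set R) (t : R) : I t ->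
  measurable_fun setT (X t : sigma_type X I -> R).
Proof. by move=> It _ A mA; apply: sub_sigma_algebra; exists t => //; exists A. Qed.

Lemma history_measurable d (T : measurableType d) (R : realType)
    (P : probability T R) (X : R -> {RV P >-> R}) (t : R) : 0 <= t ->
  measurable_fun setT (X t : history X -> R).
Proof. by move=> t0; apply: sigma_process_measurable; rewrite /= in_itv/= andbT. Qed.

Lemma sigma_process_sub d (T : measurableType d) (R : realType)
    (P : probability T R) (X : R -> {RV P >-> R}) (I : set R) :
  sigma_process X I `<=` measurable.
Proof.
apply: smallest_sub; first exact: sigma_algebra_measurable.
by move=> _ [t _ [B mB <-]]; rewrite setTI; exact: measurable_preimage.
Qed.

Lemma sub_sigma_process d (T : measurableType d) (R : realType)
    (P : probability T R) (X Y : R -> {RV P >-> R}) (I J : set R) :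
  (forall t, I t -> forall A, measurable A -> sigma_process Y J (X t @^-1` A)) ->
  sigma_process X I `<=` sigma_process Y J.
Proof.
move=> XY; apply: smallest_sub; first exact: smallest_sigma_algebra.
by move=> _ [t It [B mB <-]]; rewrite setTI; exact: XY.
Qed.

(** * Uniqueness of the laws of Brownian motion and of the Bessel process *)

Section brownian_grid.
Context d (T : measurableType d) (R : realType) (P : probability T R).

(** By induction: the first n increments belong to the past of time n h, of
    which the next increment is independent. *)
Lemma brownian_increments (B : R -> {RV P >-> R}) (h : R) (n : nat)
    (A : nat -> set R) : brownian_motion B -> 0 < h ->
  (forall i, measurable (A i)) ->
  P [set w | forall i, (i < n)%N -> A i (B (i.+1%:R * h) w - B (i%:R * h) w)] =
  (\prod_(i < n) normal_prob 0 (Num.sqrt h) (A i))%E.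
Proof.
move=> [_ normB indB] h0 mA.
pose S m := [set w | forall i, (i < m)%N ->
  A i (B (i.+1%:R * h) w - B (i%:R * h) w)].
rewrite -/(S n).
have SS m : S m.+1 = S m `&`
    ((fun w => B (m.+1%:R * h) w - B (m%:R * h) w) @^-1` (A m)).
  apply/seteqP; split=> w /=.
    by move=> H; split; [move=> i im; apply: H; rewrite ltnS ltnW|exact: H].
  by move=> [H1 H2] i; rewrite ltnS leq_eqVlt => /predU1P[->//|]; exact: H1.
have S0 : S 0%N = setT by apply/seteqP; split.
have mS m s : m%:R * h <= s -> sigma_process B `[0, s]%classic (S m).
  elim: m => [|m IH] ms.
    rewrite S0; exact: (@measurableT _ (sigma_type B `[0, s]%classic)).
  rewrite SS; apply: (@measurableI _ (sigma_type B `[0, s]%classic)).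
    by apply: IH; apply: le_trans ms; rewrite (ler_wpM2r (ltW h0))// ler_nat.
  apply: measurable_preimage => //; apply: measurable_funB.
    apply: sigma_process_measurable => /=; rewrite in_itv/= ms andbT.
    by rewrite mulr_ge0// ltW.
  apply: sigma_process_measurable => /=; rewrite in_itv/= (mulr_ge0 (ler0n _ _) (ltW h0))/=.
  by rewrite (le_trans _ ms)// (ler_wpM2r (ltW h0))// ler_nat.
elim: n => [|n IH]; first by rewrite S0 probability_setT big_ord0.
rewrite SS big_ord_recr/= -IH.
have lt1 : n%:R * h < n.+1%:R * h by rewrite ltr_pM2r// ltr_nat.
have le0 : 0 <= n%:R * h by rewrite mulr_ge0// ltW.
have e1 := normB _ _ le0 lt1 (A n) (mA n).
have e2 : n.+1%:R * h - n%:R * h = h by rewrite -mulrBl -natrB// subSnn mul1r.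
rewrite e2 in e1; rewrite -e1.
by apply: (indB _ _ le0 lt1); [exact: mS|exists (A n); rewrite ?setTI].
Qed.

End brownian_grid.

Section brownian_unique.
Context d (T : measurableType d) d' (T' : measurableType d') (R : realType).
Context (P : probability T R) (P' : probability T' R).

(** The values on the grid are the partial sums of the increments, whose joint
    law is Gaussian and explicit. *)
Lemma brownian_grid_unique (B : R -> {RV P >-> R}) (B' : R -> {RV P' >-> R})
    (h : R) (n : nat) (A : 'I_n -> set R) :
  brownian_motion0 B -> brownian_motion0 B' -> 0 < h ->
  (forall i, measurable (A i)) ->
  P [set w | forall i : 'I_n, A i (B (i%:R * h) w)] =
  P' [set w | forall i : 'I_n, A i (B' (i%:R * h) w)].
Proof.
move=> [bB Bz] [bB' B'z] h0 mA.
pose D d (T : measurableType d) (P : probability T R) (B : R -> {RV P >-> R}) w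
  : path_space 'I_n R := fun i => B (i.+1%:R * h) w - B (i%:R * h) w.
pose F (x : path_space 'I_n R) : path_space 'I_n R :=
  fun i => \sum_(j < n | (j < i)%N) x j.
have mD d0 (T0 : measurableType d0) (P0 : probability T0 R)
    (B0 : R -> {RV P0 >-> R}) i : measurable_fun setT (fun w => D _ _ _ B0 w i).
  exact: measurable_funB.
have mF : measurable_fun setT F.
  apply: measurable_path => i.
  pose F' (x : path_space 'I_n R) :=
    \sum_(j < n) if (j < i)%N then x j else 0.
  apply: (eq_measurable_fun F') => [x _|]; first by rewrite /F' -big_mkcond.
  by apply: measurable_sum => j; case: (j < i)%N => //; exact: measurable_coord.
have FD d0 (T0 : measurableType d0) (P0 : probability T0 R)
    (B0 : R -> {RV P0 >-> R}) w i : F (D _ _ _ B0 w) i = B0 (i%:R * h) w - B0 0 w.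
  rewrite /F /D -(big_ord_widen _ (fun j => B0 (j.+1%:R * h) w - B0 (j%:R * h) w)) 1?ltnW//.
  rewrite -(big_mkord xpredT (fun j => B0 (j.+1%:R * h) w - B0 (j%:R * h) w)).
  by rewrite telescope_sumr// mul0r.
have := @same_law_box 'I_n R _ _ _ _ P P' (D _ _ _ B) (D _ _ _ B') (mD _ _ _ _) (mD _ _ _ _).
have incr d0 (T0 : measurableType d0) (P0 : probability T0 R)
    (B0 : R -> {RV P0 >-> R}) (C : 'I_n -> set R) : brownian_motion B0 ->
    (forall i, measurable (C i)) ->
    P0 [set w | forall i, C i (D _ _ _ B0 w i)] =
    (\prod_(i < n) normal_prob 0 (Num.sqrt h) (C i))%E.
  move=> bB0 mC.
  (* boxes over 'I_n as boxes over nat, unconstrained beyond n *)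
  pose C' i := if insub i is Some j then C j else setT.
  have C'E (i : 'I_n) : C' i = C i by rewrite /C' valK.
  have := @brownian_increments _ _ _ _ B0 h n C' bB0 h0.
  under eq_bigr do rewrite C'E.
  move=> <-; last by move=> i; rewrite /C'; case: insubP.
  congr (P0 _); apply/seteqP; split=> w /= H i.
    by move=> i_n; have := H (Ordinal i_n); rewrite -C'E.
  by have := H i (ltn_ord i); rewrite C'E.
move=> /(_ (fun C mC => etrans (incr _ _ _ _ C bB mC) (esym (incr _ _ _ _ C bB' mC)))).
move=> /(same_law_comp mF) => sl.
have mbox : measurable ([set x | forall i, A i (x i)] : set (path_space 'I_n R)).
  by apply: sub_sigma_algebra; exists A.
have := sl _ mbox.
have key d0 (T0 : measurableType d0) (P0 : probability T0 R)
    (B0 : R -> {RV P0 >-> R}) : {ae P0, forall w, B0 0 w = 0} ->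
    P0 ((F \o D _ _ _ B0) @^-1` [set x | forall i, A i (x i)]) =
    P0 [set w | forall i : 'I_n, A i (B0 (i%:R * h) w)].
  move=> B00; apply: ae_eq_probability.
  - apply: measurable_preimage => //; apply: measurableT_comp => //.
    by apply: measurable_path; exact: mD.
  - by apply: (@measurable_box 'I_n R _ _ (fun w i => B0 (i%:R * h) w)).
  - apply: filterS B00 => w w0 /=; split=> H i; have := H i; by rewrite FD w0 subr0.
by rewrite (key _ _ _ _ Bz) (key _ _ _ _ B'z).
Qed.

(** Independence of the coordinates splits the probability of a box into a
    product over the coordinates. *)
Lemma brownian3_grid_unique (B : 'I_3 -> R -> {RV P >-> R})
    (B' : 'I_3 -> R -> {RV P' >-> R}) (h : R) (n : nat)
    (A : 'I_3 * 'I_n -> set R) :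
  brownian_motion3 B -> brownian_motion3 B' -> 0 < h ->
  (forall i, measurable (A i)) ->
  P [set w | forall i : 'I_3 * 'I_n, A i (B i.1 (i.2%:R * h) w)] =
  P' [set w | forall i : 'I_3 * 'I_n, A i (B' i.1 (i.2%:R * h) w)].
Proof.
move=> [bB iB] [bB' iB'] h0 mA.
pose S d (T : measurableType d) (P : probability T R)
  (B : 'I_3 -> R -> {RV P >-> R}) k :=
  [set w | forall i : 'I_n, A (k, i) (B k (i%:R * h) w)].
have SE d0 (T0 : measurableType d0) (P0 : probability T0 R)
    (B0 : 'I_3 -> R -> {RV P0 >-> R}) :
    [set w | forall i : 'I_3 * 'I_n, A i (B0 i.1 (i.2%:R * h) w)] =
    \bigcap_k S _ _ _ B0 k.
  apply/seteqP; split=> w /= H; first by move=> k _ i; exact: (H (k, i)).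
  by move=> [k i]; exact: (H k I i).
have mS d0 (T0 : measurableType d0) (P0 : probability T0 R)
    (B0 : 'I_3 -> R -> {RV P0 >-> R}) k :
    sigma_process (B0 k) `[0, +oo[%classic (S _ _ _ B0 k).
  apply: (@measurable_box 'I_n R _ (history (B0 k))
    (fun w i => B0 k (i%:R * h) w) (fun i => A (k, i))) => // i.
  by apply: history_measurable; rewrite mulr_ge0// ltW.
rewrite !SE iB// iB'//; apply: eq_bigr => k _.
exact: (@brownian_grid_unique (B k) (B' k) h n (fun i => A (k, i))).
Qed.

End brownian_unique.

(** The two Brownian motions behind [rho] and [rho'] live on unrelated spaces
    but have the same law on the grid, and the Euclidean norm is a measurable
    function of their values. *)
Lemma bessel_grid_unique d (T : measurableType d) d' (T' : measurableType d')
    (R : realType) (P : probability T R) (P' : probability T' R)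
    (rho : R -> {RV P >-> R}) (rho' : R -> {RV P' >-> R}) (h : R) (n : nat) :
  bessel3 rho -> bessel3 rho' -> 0 < h ->
  same_law P P' (fun w => (fun i => rho (i%:R * h) w) : path_space 'I_n R)
                (fun w => (fun i => rho' (i%:R * h) w) : path_space 'I_n R).
Proof.
move=> [_ [d1 [W1 [Q1 [B1 [bB1 rhoE]]]]]] [_ [d2 [W2 [Q2 [B2 [bB2 rho'E]]]]]] h0.
apply: same_law_box => // A mA.
rewrite rhoE//; last by move=> i; rewrite mulr_ge0// ltW.
rewrite rho'E//; last by move=> i; rewrite mulr_ge0// ltW.
pose N (x : path_space ('I_3 * 'I_n)%type R) : path_space 'I_n R :=
  fun i => Num.sqrt (\sum_(k < 3) x (k, i) ^+ 2).
have mN : measurable_fun setT N.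
  apply: measurable_path => i; apply: measurableT_comp.
    by apply: continuous_measurable_fun; exact: sqrt_continuous.
  apply: measurable_sum => k; apply: measurable_funX; exact: measurable_coord.
have sl : same_law Q1 Q2
    (fun w => (fun i => B1 i.1 (i.2%:R * h) w) : path_space ('I_3 * 'I_n)%type R)
    (fun w => (fun i => B2 i.1 (i.2%:R * h) w) : path_space ('I_3 * 'I_n)%type R).
  apply: same_law_box => // C mC.
  exact: (@brownian3_grid_unique _ _ _ _ R Q1 Q2 B1 B2 h n C).
apply: (same_law_comp mN sl (A := [set x | forall i, A i (x i)])).
by apply: sub_sigma_algebra; exists A.
Qed.

(** * Brownian and Bessel scaling *)

(** Freezing a path before time 0 turns continuity on [0, +oo[ into continuity
    on the whole line. *)
Lemma continuous_max0 (R : realType) (f : R -> R) :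
  {within `[0, +oo[%classic, continuous f} ->
  continuous (fun t : R => f (Num.max 0 t)).
Proof.
move=> /subspace_continuousP cf x.
have x0 : `[0, +oo[%classic (Num.max 0 x) by rewrite /= in_itv/= andbT le_max lexx.
apply: cvg_comp (cf _ x0) => U [/= e e0 eU].
have cm : (fun t : R => Num.max 0 t) t @[t --> x] --> Num.max 0 x.
  by apply: (@continuous_max R R (cst 0) id); [exact: cvg_cst|exact: cvg_id].
have /cm : nbhs (Num.max 0 x) (ball (Num.max 0 x) e) by exact: nbhsx_ballx.
rewrite !nbhs_simpl/=; apply: filterS => y ye; apply: eU => //=.
by rewrite in_itv/= andbT le_max lexx.
Qed.

Lemma continuous_within0 (R : realType) (f g : R -> R) :
  continuous g -> (forall t, 0 <= t -> f t = g t) ->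
  {within `[0, +oo[%classic, continuous f}.
Proof.
move=> cg fg; apply: (@subspace_eq_continuous _ _ _ g).
  by move=> t; rewrite inE/= in_itv/= andbT => /fg.
exact: continuous_subspaceT.
Qed.

(** The distribution functions agree by the change of variables x = c y. *)
Lemma normal_prob_scale (R : realType) (c s : R) (A : set R) :
  0 < c -> 0 < s -> measurable A ->
  normal_prob 0 (c * s) ((fun x => c^-1 * x) @^-1` A) = normal_prob 0 s A.
Proof.
move=> c0 s0 mA.
have cs0 : 0 < c * s by exact: mulr_gt0.
have mX : measurable_fun setT (fun x : measurableTypeR R => c^-1 * x).
  exact: measurable_funM.
have mY : measurable_fun setT (fun x : measurableTypeR R => x) by [].
have := @same_law_lt _ _ _ _ R (normal_prob 0 (c * s)) (normal_prob 0 s)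
  (fun x => c^-1 * x) (fun x => x) mX mY.
move=> /(_ _)/(_ _ mA); apply => a.
have cE (m : R) (x : R) : 0 < m ->
   measurable_fun `]-oo, x[%classic (fun y => (normal_pdf 0 m y)%:E).
  by move=> m0; apply/measurable_EFinP/measurable_funTS; exact: measurable_normal_pdf.
have E (m x : R) : 0 < m -> normal_prob 0 m [set w | w < x] =
    (\int[lebesgue_measure]_(y in `]-oo, x]) (normal_pdf 0 m y)%:E)%E.
  move=> m0; rewrite (_ : [set w | w < x] = `]-oo, x[%classic); last first.
    by apply/seteqP; split=> y /=; rewrite in_itv/=.
  by apply: integral_itv_bndo_bndc; exact: cE.
rewrite (_ : [set w | c^-1 * w < a] = [set w | w < c * a]); last first.
  by apply/seteqP; split=> x /=; rewrite ltr_pdivrMl.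
apply: (etrans (E _ _ cs0)); apply: (etrans _ (esym (E _ _ s0))).
have dE : (( *%R c)^`() = cst c)%classic.
  by apply/funext => x; rewrite derive1E deriveM// derive_id derive_cst scaler0 addr0 /GRing.scale/= mulr1.
rewrite (@increasing_ge0_integration_by_substitutionNy R ( *%R c)).
- apply: eq_integral => x _; congr EFin; rewrite !fctE dE /=.
  have pk : normal_peak (c * s) * c = normal_peak s.
    rewrite /normal_peak exprMn -mulrA -mulrnAr sqrtrM ?sqr_ge0// sqrtr_sqr.
    by rewrite gtr0_norm// invfM mulrAC mulVf ?mul1r// gt_eqF.
  have fn : normal_fun 0 (c * s) (c * x) = normal_fun 0 s x.
    have e : (c * x) ^+ 2 / ((c * s) ^+ 2 *+ 2) = x ^+ 2 / (s ^+ 2 *+ 2).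
      rewrite !exprMn -mulrnAr -mulf_div divff ?mul1r//.
      by rewrite expf_neq0// gt_eqF.
    by rewrite /normal_fun !subr0 !mulNr e.
  by rewrite !normal_pdfE ?gt_eqF// fn mulrAC pk.
- by move=> x y _ _ xy; rewrite ltr_pM2l.
- by move=> x _; rewrite dE; exact: cvg_cst.
- by rewrite dE; exact: is_cvg_cst.
- by rewrite dE; exact: cvg_cst.
- split; first by move=> x _; exact: derivableM.
  by apply: cvg_at_left_filter; exact: mulrl_continuous.
- by apply/gt0_cvgMrNy => //; exact: cvg_id.
- by apply: continuous_subspaceT; apply: continuous_normal_pdf; rewrite gt_eqF.
- by move=> x _; exact: normal_pdf_ge0.
Qed.

Section scaled.
Context d (T : measurableType d) (R : realType) (P : probability T R).

Lemma measurable_scaled (c : R) (X : R -> {RV P >-> R}) (t : R) :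
  measurable_fun setT (fun w => c^-1 * X (c ^+ 2 * t) w).
Proof. exact: measurable_funM. Qed.

Definition scaled (c : R) (X : R -> {RV P >-> R}) : R -> {RV P >-> R} :=
  fun t => mfun_of (measurable_scaled c X t).

Lemma continuous_scaled (c : R) (X : R -> {RV P >-> R}) :
  continuous_paths X -> continuous_paths (scaled c X).
Proof.
move=> cX w; pose g (t : R) : R := X (Num.max 0 t) w.
have cg : continuous g := continuous_max0 (cX w).
apply: (@continuous_within0 _ _ (fun t : R => c^-1 * g (c ^+ 2 * t))).
  move=> t; apply: cvgM; first exact: cvg_cst.
  apply: (@continuous_comp _ _ _ ( *%R (c ^+ 2)) g); last exact: cg.
  exact: mulrl_continuous.
by move=> t t0; rewrite /g /= (max_idPr _)// mulr_ge0// sqr_ge0.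
Qed.

Lemma brownian_scaled (c : R) (B : R -> {RV P >-> R}) : 0 < c ->
  brownian_motion0 B -> brownian_motion0 (scaled c B).
Proof.
move=> c0 [[cB nB iB] B0].
have c20 : 0 < c ^+ 2 by rewrite exprn_gt0.
have c2le s : 0 <= s -> 0 <= c ^+ 2 * s by move=> s0; rewrite mulr_ge0// ltW.
have c2lt s t : s < t -> c ^+ 2 * s < c ^+ 2 * t by move=> st; rewrite ltr_pM2l.
have incr s t A : (fun w => scaled c B t w - scaled c B s w) @^-1` A =
    (fun w => B (c ^+ 2 * t) w - B (c ^+ 2 * s) w) @^-1`
      ((fun x => c^-1 * x) @^-1` A).
  by apply/seteqP; split=> w /=; rewrite mulrBr.
have mc (A : set R) : measurable A -> measurable ((fun x : R => c^-1 * x) @^-1` A).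
  by move=> mA; apply: measurable_preimage => //; exact: measurable_funM.
split; last first.
  by apply: filterS B0 => w w0; rewrite /= mulr0 w0 mulr0.
split.
- exact: continuous_scaled.
- move=> s t s0 st A mA.
  rewrite incr (nB _ _ (c2le _ s0) (c2lt _ _ st) _ (mc _ mA)) -mulrBr.
  rewrite (sqrtrM _ (ltW c20)) sqrtr_sqr (gtr0_norm c0) normal_prob_scale//.
  by rewrite sqrtr_gt0 subr_gt0.
- move=> s t s0 st A C sA [D mD <-]; rewrite setTI incr.
  apply: (iB _ _ (c2le _ s0) (c2lt _ _ st)).
    move: A sA; apply: sub_sigma_process => u; rewrite /= in_itv/= => /andP[u0 us] A mA.
    apply: sub_sigma_algebra; exists (c ^+ 2 * u).
      by rewrite /= in_itv/= c2le//= ler_pM2l.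
    by exists ((fun x => c^-1 * x) @^-1` A); rewrite ?setTI//; exact: mc.
  by exists ((fun x => c^-1 * x) @^-1` D); rewrite ?setTI//; exact: mc.
Qed.

End scaled.

Lemma bessel_scaled d (T : measurableType d) (R : realType)
    (P : probability T R) (c : R) (rho : R -> {RV P >-> R}) : 0 < c ->
  bessel3 rho -> bessel3 (scaled c rho).
Proof.
move=> c0 [crho [d1 [W1 [Q1 [B1 [[bB1 iB1] rhoE]]]]]].
have c20 : 0 < c ^+ 2 by rewrite exprn_gt0.
have c2le s : 0 <= s -> 0 <= c ^+ 2 * s by move=> s0; rewrite mulr_ge0// ltW.
have mc (A : set R) : measurable A -> measurable ((fun x : R => c^-1 * x) @^-1` A).
  by move=> mA; apply: measurable_preimage => //; exact: measurable_funM.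
split; first exact: continuous_scaled.
exists d1, W1, Q1, (fun k => scaled c (B1 k)); split.
  split; first by move=> i; exact: brownian_scaled.
  move=> A sA; apply: iB1 => i; move: (A i) (sA i).
  apply: sub_sigma_process => u; rewrite /= in_itv/= andbT => u0 C mC.
  apply: sub_sigma_algebra; exists (c ^+ 2 * u).
    by rewrite /= in_itv/= c2le.
  by exists ((fun x => c^-1 * x) @^-1` C); rewrite ?setTI//; exact: mc.
move=> n t A t0 mA.
have := rhoE n (fun i => c ^+ 2 * t i) (fun i => (fun x => c^-1 * x) @^-1` A i).
move=> /(_ (fun i => c2le _ (t0 i)) (fun i => mc _ (mA i))) /= ->.
have E i w : Num.sqrt (\sum_(k < 3) scaled c (B1 k) (t i) w ^+ 2) =
    c^-1 * Num.sqrt (\sum_(k < 3) B1 k (c ^+ 2 * t i) w ^+ 2).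
  transitivity (Num.sqrt (c^-1 ^+ 2 * \sum_(k < 3) B1 k (c ^+ 2 * t i) w ^+ 2)).
    by congr Num.sqrt; rewrite mulr_sumr; apply: eq_bigr => k _; rewrite -exprMn.
  by rewrite sqrtrM ?sqr_ge0// sqrtr_sqr gtr0_norm ?invr_gt0.
by congr (Q1 _); apply/seteqP; split=> w /= H i; have := H i; rewrite E.
Qed.

(** * Grids on a compact interval *)

Section grid.
Context (R : realType).
Notation mu := (@lebesgue_measure R).

Definition grid_sum (f : R -> R) (v : R) (n : nat) : R :=
  \sum_(k < n.+1) f (k%:R * (v / n.+1%:R)) * (v / n.+1%:R).

Lemma step_cvg0 (v : R) : v / n.+1%:R @[n --> \oo] --> (0 : R).
Proof.
rewrite -[X in _ --> X](mulr0 v); apply: cvgM; first exact: cvg_cst.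
exact: (@cvg_harmonic R).
Qed.

Lemma truncn_grid (h x : R) : 0 < h -> 0 <= x ->
  (Num.truncn (x / h))%:R * h <= x < (Num.truncn (x / h)).+1%:R * h.
Proof.
move=> h0 x0; have /truncn_itv/andP[] : 0 <= x / h by rewrite divr_ge0// ltW.
by rewrite ler_pdivlMr// ltr_pdivrMr// => -> ->.
Qed.

Lemma truncn_grid_cvg (v x : R) : 0 < v -> 0 <= x ->
  (Num.truncn (x / (v / n.+1%:R)))%:R * (v / n.+1%:R) @[n --> \oo] --> x.
Proof.
move=> v0 x0.
apply: (@squeeze_cvgr _ _ _ _ (fun n => x - v / n.+1%:R) (cst x)).
- apply: nearW => n /=; have h0 : 0 < v / n.+1%:R by rewrite divr_gt0.
  have /andP[-> +] := truncn_grid h0 x0.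
  by rewrite -[in X in x < X]natr1 mulrDl mul1r andbT lerBlDr => /ltW.
- rewrite -[X in _ --> X]subr0; apply: cvgB; first exact: cvg_cst.
  exact: step_cvg0.
- exact: cvg_cst.
Qed.

Lemma continuous_bounded_itv (f : R -> R) (a b : R) : continuous f ->
  exists M, forall x, a <= x <= b -> `|f x| <= M.
Proof.
move=> cf; have [ab|ba] := leP a b; last first.
  exists 0 => x /andP[ax xb]; have := le_trans ax xb; by rewrite leNgt ba.
have cn : {within `[a, b], continuous (fun x => `|f x|)}.
  apply: continuous_subspaceT => x.
  by apply: continuous_comp; [exact: cf|exact: norm_continuous].
have [c _ cM] := EVT_max ab cn.
by exists `|f c| => x xab; apply: cM; rewrite in_itv/=.
Qed.

Lemma continuous_itv_integrable (f : R -> R) (a b : R) : continuous f ->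
  mu.-integrable `[a, b] (EFin \o f).
Proof.
move=> cf; apply: continuous_compact_integrable; first exact: segment_compact.
exact: continuous_subspaceT.
Qed.

(** The sum is the integral of a step function which, by continuity, converges
    pointwise to [f] and is bounded by the maximum of [f]. *)
Lemma grid_sum_cvg (f : R -> R) (v : R) :
  continuous f -> (forall x, 0 <= f x) -> 0 < v ->
  grid_sum f v n @[n --> \oo] --> \int[mu]_(x in `[0, v]) f x.
Proof.
move=> cf f0 v0.
pose h n : R := v / n.+1%:R.
have h0 n : 0 < h n by rewrite divr_gt0.
pose I n (k : nat) : set R := `[k%:R * h n, k.+1%:R * h n[%classic.
pose s n (x : R) : R := \sum_(k < n.+1) f (k%:R * h n) * \1_(I n k) x.
have mI n k : measurable (I n k) by exact: measurable_itv.
have muI n k : mu (I n k) = (h n)%:E.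
  rewrite /I lebesgue_measure_itv/= lte_fin ltr_pM2r// ltr_nat ltnSn.
  by rewrite -EFinD -mulrBl -natrB// subSnn mul1r.
have mf : measurable_fun setT f by exact: continuous_measurable_fun.
have ms n : measurable_fun setT (s n).
  apply: measurable_sum => k.
  by apply: measurable_funM => //; exact: measurable_indic.
have tv n x : 0 <= x < v -> (Num.truncn (x / h n) < n.+1)%N.
  move=> /andP[x0 xv]; rewrite ltnS truncn_le_nat ltr_pdivrMr//.
  by rewrite /h mulrCA divff// mulr1.
have sE n x : 0 <= x < v -> s n x = f ((Num.truncn (x / h n))%:R * h n).
  move=> xv; have x0 : 0 <= x by case/andP: xv.
  have /andP[le1 lt1] := truncn_grid (h0 n) x0.
  rewrite /s (bigD1 (Ordinal (tv n x xv)))//= indicE mem_set ?mulr1; last first.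
    by rewrite /I /= in_itv/= le1 lt1.
  rewrite big1 ?addr0// => k kx; rewrite indicE memNset ?mulr0// /I /= in_itv/=.
  move=> /andP[kx1 kx2]; move/eqP: kx; apply; apply/val_inj => /=.
  apply/esym/truncn_def; rewrite ler_pdivlMr// ltr_pdivrMr//.
  by rewrite kx1 kx2.
have [M fM] := continuous_bounded_itv 0 v cf.
have := @dominated_convergence _ _ R mu `[0, v[%classic (measurable_itv _)
  (fun n => EFin \o s n) (EFin \o f) (EFin \o cst M).
case.
- by move=> n; apply/measurable_EFinP; apply: measurable_funTS; exact: ms.
- by apply/measurable_EFinP; apply: measurable_funTS; exact: mf.
- apply: aeW => x /=; rewrite in_itv/= => xv; apply/cvg_EFin; first exact: nearW.
  rewrite /comp /=; under eq_fun do rewrite sE//.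
  apply: (@continuous_cvg _ _ _ _ _ _ f); first exact: cf.
  by apply: truncn_grid_cvg => //; case/andP: xv.
- apply: (@integrableS _ _ _ mu `[0, v]%classic) => //.
    by move=> x; rewrite /= !in_itv/= => /andP[-> /ltW].
  by apply: (@continuous_itv_integrable (cst M)) => x; exact: cvg_cst.
- apply: aeW => x n /=; rewrite in_itv/= lee_fin => xv; rewrite sE//; apply: fM.
  have x0 : 0 <= x by case/andP: xv.
  have /andP[le1 _] := truncn_grid (h0 n) x0.
  rewrite mulr_ge0 ?(ltW (h0 n))//= (le_trans le1)//.
  by case/andP: xv => _ /ltW.
move=> intf _; rewrite -[X in _ --> X -> _]fineK; last first.
  exact: integrable_fin_num.
move=> /fine_cvg cv.
rewrite -Rintegral_itv_bndo_bndc//.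
have e n : fine (\int[mu]_(x in `[0%R, v[) (s n x)%:E)%E = grid_sum f v n.
  rewrite /s; under eq_integral => x _.
    rewrite -sumEFin; under eq_bigr do rewrite EFinM.
  over.
  rewrite ge0_integral_sum//; last 2 first.
    move=> k; apply/measurable_EFinP; apply: measurable_funTS.
    apply: measurable_funM => //; apply: measurable_indic; exact: mI.
    by move=> k x _; rewrite lee_fin mulr_ge0.
  rewrite (eq_bigr (fun k : 'I_n.+1 => (f (k%:R * h n) * h n)%:E)) ?sumEFin//.
  move=> k _; rewrite ge0_integralZl//; last 2 first.
      apply/measurable_EFinP; apply: measurable_funTS.
      by apply: measurable_indic; exact: mI.
    by rewrite lee_fin.
  rewrite integral_indic; [|by []|exact: mI].
  rewrite setIidl ?EFinM; first by congr (_ * _)%E; exact: muI.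
  move=> x; rewrite /I /= !in_itv/= => /andP[x1 x2]; apply/andP; split.
    by apply: le_trans x1; rewrite mulr_ge0// ltW.
  apply: (lt_le_trans x2); rewrite /h mulrA ler_pdivrMr// mulrC.
  by rewrite ler_pM2l// ler_nat.
move: cv; rewrite /Rintegral; apply: cvg_trans.
by apply: near_eq_cvg; apply: nearW => n; rewrite -e.
Qed.

Definition runmax (f : R -> R) (v : R) : R := sup [set f x | x in `[0, v]%classic].

(** The points are k v / (n + 1) for k = 0, ..., n + 1, so that both end points
    belong to the grid. *)
Definition grid_max (f : R -> R) (v : R) (n : nat) : R :=
  \big[Num.max/f 0]_(k < n.+2) f (k%:R * (v / n.+1%:R)).

Lemma runmax_attained (f : R -> R) (v : R) : continuous f -> 0 <= v ->
  exists c, [/\ 0 <= c <= v, runmax f v = f c &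
    forall x, 0 <= x <= v -> f x <= f c].
Proof.
move=> cf v0.
have [c c0v cM] := EVT_max v0 (continuous_subspaceT cf).
rewrite in_itv/= in c0v; exists c.
have cM' x : 0 <= x <= v -> f x <= f c by move=> x0v; apply: cM; rewrite in_itv.
split=> //; apply/eqP; rewrite eq_le; apply/andP; split.
  apply: sup_le_ub; first by exists (f c), c => //=; rewrite in_itv.
  by move=> _ [x xv <-]; apply: cM'; move: xv; rewrite /= in_itv.
apply: ub_le_sup; last by exists c => //=; rewrite in_itv.
by exists (f c) => _ [x xv <-]; apply: cM'; move: xv; rewrite /= in_itv.
Qed.

(** The grid point just before a point where the maximum is attained converges
    to that point. *)
Lemma grid_max_cvg (f : R -> R) (v : R) : continuous f -> 0 < v ->
  grid_max f v n @[n --> \oo] --> runmax f v.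
Proof.
move=> cf v0; have [c [/andP[c0 cv] -> cM]] := runmax_attained cf (ltW v0).
have le_c n : grid_max f v n <= f c.
  rewrite /grid_max; apply: bigmax_le; first by apply: cM; rewrite lexx ltW.
  move=> k _; apply: cM; rewrite mulr_ge0 ?divr_ge0 ?(ltW v0)//=.
  by rewrite mulrA ler_pdivrMr// mulrC ler_pM2l// ler_nat -ltnS.
have ge_c n : f ((Num.truncn (c / (v / n.+1%:R)))%:R * (v / n.+1%:R)) <= grid_max f v n.
  have lt : (Num.truncn (c / (v / n.+1%:R)) < n.+2)%N.
    rewrite ltnS truncn_le_nat ltr_pdivrMr ?divr_gt0// mulrA ltr_pdivlMr//.
    apply: (le_lt_trans (ler_wpM2r _ cv)) => //.
    by rewrite mulrC ltr_pM2r// ltr_nat.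
  exact: (@le_bigmax _ _ _ _ (fun k : 'I_n.+2 => f (k%:R * (v / n.+1%:R))) (Ordinal lt)).
apply: (@squeeze_cvgr _ _ _ _
  (fun n => f ((Num.truncn (c / (v / n.+1%:R)))%:R * (v / n.+1%:R))) (cst (f c))).
- by apply: nearW => n; rewrite ge_c le_c.
- apply: (@continuous_cvg _ _ _ _ _ _ f); first exact: cf.
  exact: truncn_grid_cvg.
- exact: cvg_cst.
Qed.

End grid.

(** * Measurability along continuous paths *)

(** The continuous functions x / (x^2 + 1 / (n + 1)) converge to x^-1 everywhere,
    including 0, since 0^-1 = 0. *)
Lemma measurable_invr (R : realType) : measurable_fun setT (fun x : R => x^-1).
Proof.
have den (x : R) n : 0 < x ^+ 2 + n.+1%:R^-1.
  by rewrite ltr_wpDl ?sqr_ge0// invr_gt0.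
apply: (@measurable_fun_cvg _ _ _ setT
  (fun n (x : R) => x / (x ^+ 2 + n.+1%:R^-1))).
  move=> n; apply: continuous_measurable_fun => x.
  apply: cvgM; first exact: cvg_id.
  apply: cvgV; first by rewrite gt_eqF.
  by apply: cvgD; [exact: exprn_continuous|exact: cvg_cst].
move=> x _; have [->|x0] := eqVneq x 0.
  rewrite invr0; under eq_fun do rewrite mul0r; exact: cvg_cst.
have -> : x^-1 = x / (x ^+ 2 + 0) by rewrite addr0 expr2 invfM mulrA divff// mul1r.
apply: cvgM; first exact: cvg_cst.
apply: cvgV; first by rewrite addr0 expf_neq0.
by apply: cvgD; [exact: cvg_cst|exact: (@cvg_harmonic R)].
Qed.

Lemma measurable_fun_select d (E : measurableType d) d' (F : measurableType d')
    (N : E -> nat) (g : nat -> E -> F) :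
  (forall k, measurable [set e | (N e <= k)%N]) ->
  (forall k, measurable_fun setT (g k)) ->
  measurable_fun setT (fun e => g (N e) e).
Proof.
move=> mN mg _ A mA; rewrite setTI.
have mN' k : measurable [set e | N e = k].
  case: k => [|k].
    rewrite (_ : [set e | _] = [set e | (N e <= 0)%N])//.
    by apply/seteqP; split=> e /= => [->//|]; rewrite leqn0 => /eqP.
  rewrite (_ : [set e | _] = [set e | (N e <= k.+1)%N] `\` [set e | (N e <= k)%N]).
    exact: measurableD.
  apply/seteqP; split=> e /= => [->|[]]; first by split=> //; rewrite ltnn.
  by rewrite leq_eqVlt ltnS => /predU1P[//|-> //].
rewrite (_ : _ @^-1` A = \bigcup_k ([set e | N e = k] `&` g k @^-1` A)).
  by apply: bigcup_measurable => k _; apply: measurableI => //; exact: measurable_preimage.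
by apply/seteqP; split=> e /= => [Ae|[k _ [<- //]]]; exists (N e).
Qed.

Section joint.
Context d (T : measurableType d) (R : realType).
Variable X : R -> T -> R.
Hypothesis mX : forall t, 0 <= t -> measurable_fun setT (X t).
Hypothesis cX : forall w, {within `[0, +oo[%classic, continuous (fun t => X t w)}.

(** The path is the limit of its values at the last point before t of a grid of
    step 1 / (n + 1), and a function of an integer-valued measurable index is
    jointly measurable. *)
Lemma measurable_joint :
  measurable_fun setT (fun p : R * T => X (Num.max 0 p.1) p.2).
Proof.
pose N n (p : R * T) := Num.truncn (Num.max 0 p.1 / (1 / n.+1%:R)).
apply: (@measurable_fun_cvg _ (R * T)%type R setT
  (fun n p => X ((N n p)%:R * (1 / n.+1%:R)) p.2)).
  move=> n; apply: (@measurable_fun_select _ (R * T)%type _ _ (N n)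
    (fun k p => X (k%:R * (1 / n.+1%:R)) p.2)).
    move=> k; rewrite (_ : [set p | _] =
      [set p | Num.max 0 p.1 / (1 / n.+1%:R) < k.+1%:R]); last first.
      by apply/seteqP; split=> p /=; rewrite /N truncn_le_nat.
    apply: measurable_lt; apply: measurable_funM => //.
    by apply: measurable_maxr => //; exact: measurable_fst.
  move=> k; apply: measurableT_comp; last exact: measurable_snd.
  by apply: mX; rewrite mulr_ge0// divr_ge0.
move=> p _; have cg := continuous_max0 (@cX p.2).
have := @truncn_grid_cvg R 1 (Num.max 0 p.1) ltr01.
rewrite le_max lexx => /(_ isT) cv.
have := @continuous_cvg _ _ _ _ (eventually_filter) _ (fun t : R => X (Num.max 0 t) p.2) _ (cg _) cv.
rewrite /= [Num.max 0 (Num.max 0 _)](max_idPr _) ?le_max ?lexx//.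
apply: cvg_trans; apply: near_eq_cvg; apply: nearW => n /=.
by rewrite (max_idPr _)// mulr_ge0// divr_ge0.
Qed.

Lemma measurable_at_random_time (tau : T -> R) : measurable_fun setT tau ->
  (forall w, 0 <= tau w) -> measurable_fun setT (fun w => X (tau w) w).
Proof.
move=> mt t0.
have : measurable_fun setT ((fun p : R * T => X (Num.max 0 p.1) p.2) \o (fun w => (tau w, w))).
  apply: measurableT_comp; first exact: measurable_joint.
  exact: measurable_fun_pair.
by apply: eq_measurable_fun => w _ /=; rewrite (max_idPr _).
Qed.

Lemma measurable_time_integral (phi : R -> R) (v : R) :
  measurable_fun setT phi -> (forall x, 0 <= phi x) ->
  measurable_fun setT
    (fun w => \int[lebesgue_measure]_(s in `[0, v]) phi (X s w)).
Proof.
move=> mphi phi0; rewrite /Rintegral; apply: measurableT_comp => //.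
pose f (p : T * measurableTypeR R) : \bar R :=
  (phi (X (Num.max 0 p.2) p.1) * \1_(`[0, v]%classic) p.2)%:E.
have mf : measurable_fun setT f.
  apply/measurable_EFinP; apply: measurable_funM.
    apply: measurableT_comp => //.
    apply: (@measurableT_comp _ _ _ _ _ _ (fun p : R * T => X (Num.max 0 p.1) p.2) _ (fun p : T * measurableTypeR R => (p.2, p.1))).
      exact: measurable_joint.
    exact: measurable_swap.
  by apply: measurableT_comp => //; exact: measurable_snd.
have f0 x : (0 <= f x)%E by rewrite lee_fin mulr_ge0.
have := measurable_fun_fubini_tonelli_F (m2 := lebesgue_measure) f mf f0.
apply: eq_measurable_fun => w _; rewrite /fubini_F [RHS]integral_mkcond.
apply: eq_integral => s _; rewrite /f patchE indicE /=.
case: ifPn => sv; last by rewrite mulr0.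
rewrite mulr1; congr (phi (X _ w))%:E; apply/max_idPr.
by move: sv; rewrite inE/= in_itv/= => /andP[].
Qed.

Lemma measurable_runmax (v : R) : 0 < v ->
  measurable_fun setT (fun w => runmax (fun t : R => X (Num.max 0 t) w) v).
Proof.
move=> v0; apply: (@measurable_fun_cvg _ _ _ setT
  (fun n w => grid_max (fun t : R => X (Num.max 0 t) w) v n)); last first.
  by move=> w _; apply: grid_max_cvg => //; exact: continuous_max0 (@cX w).
move=> n; rewrite /grid_max.
have mX0 (t : R) : measurable_fun setT (X (Num.max 0 t)).
  by apply: mX; rewrite le_max lexx.
elim: (index_enum _) => [|k s IH].
  by apply: eq_measurable_fun (mX0 0) => w _; rewrite big_nil.
pose G w : R := Num.max (X (Num.max 0 (k%:R * (v / n.+1%:R))) w)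
  (\big[Num.max/X (Num.max 0 0) w]_(i <- s)
    X (Num.max 0 (i%:R * (v / n.+1%:R))) w).
apply: (eq_measurable_fun G) => [x _|]; first by rewrite big_cons.
exact: measurable_maxr.
Qed.

End joint.

(** * Integrals of continuous functions *)

Section real_integrals.
Context (R : realType).
Notation mu := (@lebesgue_measure R).
Implicit Types f g q : R -> R.

Lemma Rintegral_itv_split f a x b : continuous f -> a <= x -> x <= b ->
  \int[mu]_(s in `[a, b]) f s =
  \int[mu]_(s in `[a, x]) f s + \int[mu]_(s in `[x, b]) f s.
Proof.
move=> cf ax xb; have If u v := continuous_itv_integrable u v cf.
have := @Rintegral_itvB R f (BLeft a) (BRight b) x (If _ _).
rewrite !bnd_simp => /(_ ax xb) e.
rewrite -(@Rintegral_itv_obnd_cbnd _ x (BRight b)).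
  by rewrite -e addrC subrK.
apply: integrableS (If x b) => //.
by move=> y; rewrite /= !in_itv/= => /andP[/ltW -> ->].
Qed.

Lemma Rintegral_itv_cst (m a b : R) : a <= b ->
  \int[mu]_(s in `[a, b]) m = m * (b - a).
Proof.
move=> ab; rewrite Rintegral_cst//= lebesgue_measure_itv/= lte_fin.
by case: ltP => [_|ba] //=; rewrite (le_anti (introT andP (conj ab ba))) subrr.
Qed.

Lemma Rintegral_itv_ge f m a b : continuous f -> a <= b ->
  (forall x, a <= x <= b -> m <= f x) ->
  m * (b - a) <= \int[mu]_(s in `[a, b]) f s.
Proof.
move=> cf ab mf; rewrite -Rintegral_itv_cst//; apply: le_Rintegral => //.
- by apply: (@continuous_itv_integrable _ (cst m)) => x; exact: cvg_cst.
- exact: continuous_itv_integrable.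
Qed.

Lemma Rintegral_itv_le f m a b : continuous f -> a <= b ->
  (forall x, a <= x <= b -> f x <= m) ->
  \int[mu]_(s in `[a, b]) f s <= m * (b - a).
Proof.
move=> cf ab mf; rewrite -Rintegral_itv_cst//; apply: le_Rintegral => //.
- exact: continuous_itv_integrable.
- by apply: (@continuous_itv_integrable _ (cst m)) => x; exact: cvg_cst.
Qed.

(** The Riemann sums of the two sides are equal, term by term. *)
Lemma Rintegral_itv_dilate f c v : continuous f -> (forall x, 0 <= f x) ->
  0 < c -> 0 <= v ->
  \int[mu]_(s in `[0, c * v]) f s = c * \int[mu]_(s in `[0, v]) f (c * s).
Proof.
move=> cf f0 c0; rewrite le_eqVlt => /predU1P[<-|v0].
  by rewrite mulr0 set_itv1 !Rintegral_set1 mulr0.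
have cfc : continuous (fun s => f (c * s)).
  move=> s; apply: (@continuous_comp _ _ _ ( *%R c) f); last exact: cf.
  exact: mulrl_continuous.
have h1 := grid_sum_cvg cf f0 (mulr_gt0 c0 v0).
have h2 : c * grid_sum (fun s => f (c * s)) v n @[n --> \oo] -->
    c * \int[mu]_(s in `[0, v]) f (c * s).
  by apply: cvgM; [exact: cvg_cst|exact: grid_sum_cvg].
have e : grid_sum f (c * v) = fun n => c * grid_sum (fun s => f (c * s)) v n.
  apply/funext => n; rewrite /grid_sum mulr_sumr; apply: eq_bigr => k _.
  have -> : c * v / n.+1%:R = c * (v / n.+1%:R) by rewrite mulrA.
  by rewrite [RHS]mulrCA (mulrCA k%:R).
rewrite e in h1; exact: (cvg_unique _ h1 h2).
Qed.

(** A primitive based at 0; starting the integral at -1 makes it differentiable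
    on a neighbourhood of [0, +oo[. *)
Definition primitive q (x : R) : R :=
  \int[mu]_(s in `[-1, x]) q s - \int[mu]_(s in `[-1, 0]) q s.

Lemma primitiveE q (x : R) : continuous q -> 0 <= x ->
  primitive q x = \int[mu]_(s in `[0, x]) q s.
Proof.
move=> cq x0; have N10 : -1 <= 0 :> R by rewrite lerN10.
rewrite /primitive (Rintegral_itv_split cq N10 x0).
by rewrite [X in X - _]addrC addrK.
Qed.

Lemma primitive_derive q (x : R) : continuous q -> -1 < x ->
  derivable (primitive q) x 1 /\ (primitive q)^`()%classic x = q x.
Proof.
move=> cq x1.
have [||D1 D2] := @continuous_FTC1_closed _ q (-1) x (x + 1) _ _ x1 (cq x).
- by rewrite ltrDl.
- exact: continuous_itv_integrable.
have key (F : R -> R) (c : R) : derivable F x 1 -> F^`()%classic x = q x ->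
    derivable (F - cst c) x 1 /\ (F - cst c)^`()%classic x = q x.
  move=> dF F'; have dc : derivable (cst c : R -> R) x 1 by exact: derivable_cst.
  split; first exact: (derivableB dF dc).
  by rewrite derive1E (deriveB dF dc) derive_cst subr0 -derive1E; exact: F'.
exact: (key _ _ D1 D2).
Qed.

Lemma primitive_continuous q (x : R) : continuous q -> -1 < x ->
  primitive q @ x --> primitive q x.
Proof.
move=> cq /(primitive_derive cq)[+ _] => /derivable1_diffP.
exact: differentiable_continuous.
Qed.

Lemma primitive_lt q (x y : R) : continuous q -> (forall s, 0 < q s) ->
  0 <= x -> x < y -> primitive q x < primitive q y.
Proof.
move=> cq q0 x0 xy; rewrite !primitiveE// ?(le_trans x0 (ltW xy))//.
rewrite [ltRHS](@Rintegral_itv_split _ _ x)//; last exact: ltW.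
rewrite ltrDl.
have cNq : continuous (fun s => - q s) by move=> s; apply: cvgN; exact: cq.
have [c _ cM] := EVT_max (ltW xy) (continuous_subspaceT cNq).
apply: lt_le_trans (Rintegral_itv_ge (m := q c) cq (ltW xy) _).
  by rewrite mulr_gt0// subr_gt0.
by move=> s sxy; rewrite -lerN2; apply: cM; rewrite in_itv.
Qed.

Lemma Rintegral_change_clock q g t : continuous q -> (forall s, 0 < q s) ->
  continuous g -> 0 <= t ->
  \int[mu]_(u in `[0, primitive q t]) g u =
  \int[mu]_(s in `[0, t]) (g (primitive q s) * q s).
Proof.
move=> cq q0 cg t0.
have p0 : primitive q 0 = 0 by rewrite /primitive subrr.
have cd (x : R) : -1 < x -> (primitive q)^`()%classic @ x --> q x.
  move=> x1; apply: cvg_trans (cq x); apply: near_eq_cvg.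
  near=> y; symmetry; apply: (primitive_derive cq _).2.
  by near: y; exact: lt_nbhsr.
have N1 (x : R) : 0 <= x -> -1 < x by apply: lt_le_trans; rewrite ltrN10.
rewrite /Rintegral -[X in `[X, _]]p0.
rewrite (@integration_by_substitution_increasing R (primitive q) g 0 t t0).
- congr fine; apply: eq_integral => s; rewrite inE/= in_itv/= => /andP[s0 _].
  by rewrite !fctE/= (primitive_derive cq (N1 _ s0)).2.
- move=> x y; rewrite !in_itv/= => /andP[x0 _] _ xy; exact: primitive_lt.
- move=> x; rewrite in_itv/= => /andP[/ltW x0 _]; rewrite /continuous_at.
  by rewrite (primitive_derive cq (N1 _ x0)).2; apply: cd; exact: N1.
- by apply/cvg_ex; exists (q 0); apply: cvg_at_right_filter; exact: (cd 0 (N1 _ (lexx _))).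
- by apply/cvg_ex; exists (q t); apply: cvg_at_left_filter; exact: (cd t (N1 _ t0)).
- split.
  + move=> x; rewrite in_itv/= => /andP[/ltW x0 _].
    exact: (primitive_derive cq (N1 _ x0)).1.
  + by apply: cvg_at_right_filter; apply: primitive_continuous => //; exact: N1.
  + by apply: cvg_at_left_filter; apply: primitive_continuous => //; exact: N1.
- exact: continuous_subspaceT.
Unshelve. all: by end_near. Qed.

End real_integrals.

(** * Laws of functionals of the Bessel process *)

Section bessel_functionals.
Context d (T : measurableType d) d' (T' : measurableType d') (R : realType).
Context (P : probability T R) (P' : probability T' R).
Variables (rho : R -> {RV P >-> R}) (rho' : R -> {RV P' >-> R}).
Hypotheses (brho : bessel3 rho) (brho' : bessel3 rho').
Notation mu := (@lebesgue_measure R).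

(** The law on every grid is unique, hence so is the law of a limit of functions
    of the values on grids. *)
Lemma bessel_functional_law (N : nat -> nat) (h : nat -> R)
    (F : forall n, path_space 'I_(N n) R -> R) (Psi : (R -> R) -> R) :
  (forall n, 0 < h n) -> (forall n, measurable_fun setT (F n)) ->
  (forall x : R -> R, {within `[0, +oo[%classic, continuous x} ->
    F n (fun i => x (i%:R * h n)) @[n --> \oo] --> Psi x) ->
  same_law P P' (fun w => Psi (rho ^~ w)) (fun w => Psi (rho' ^~ w)).
Proof.
move=> h0 mF cvF; have [cr _] := brho; have [cr' _] := brho'.
pose X d0 (T0 : measurableType d0) (P0 : probability T0 R)
    (r : R -> {RV P0 >-> R}) n (w : T0) : path_space 'I_(N n) R :=
  fun i => r (i%:R * h n) w.
have mX d0 (T0 : measurableType d0) (P0 : probability T0 R)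
    (r : R -> {RV P0 >-> R}) n : measurable_fun setT (F n \o X _ _ _ r n).
  by apply: measurableT_comp => //; apply: measurable_path.
apply: (same_law_cvg (mX _ _ _ rho) (mX _ _ _ rho')).
- by move=> w; exact: cvF (cr w).
- by move=> w; exact: cvF (cr' w).
- by move=> n; apply: same_law_comp => //; exact: bessel_grid_unique.
Qed.

Lemma bessel_integral_law (phi : R -> R) (v : R) :
  continuous phi -> (forall x, 0 <= phi x) -> 0 < v ->
  same_law P P' (fun w => \int[mu]_(s in `[0, v]) phi (rho s w))
                (fun w => \int[mu]_(s in `[0, v]) phi (rho' s w)).
Proof.
move=> cphi phi0 v0.
apply: (@bessel_functional_law (fun n => n.+1) (fun n => v / n.+1%:R)
  (fun n x => \sum_k phi (x k) * (v / n.+1%:R))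
  (fun x => \int[mu]_(s in `[0, v]) phi (x s))).
- by move=> n; rewrite divr_gt0.
- move=> n; apply: measurable_sum => k; apply: measurable_funM => //.
  apply: measurableT_comp; first exact: continuous_measurable_fun.
  exact: measurable_coord.
- move=> x /continuous_max0 cx.
  have cf : continuous (fun s : R => phi (x (Num.max 0 s))).
    move=> s; apply: (@continuous_comp _ _ _ (fun s : R => x (Num.max 0 s)) phi).
      exact: cx.
    exact: cphi.
  have := grid_sum_cvg cf (fun=> phi0 _) v0.
  rewrite (_ : \int[mu]_(s in _) _ = \int[mu]_(s in `[0, v]) phi (x s)).
    apply: cvg_trans; apply: near_eq_cvg; apply: nearW => n.
    rewrite /grid_sum /=; apply: eq_bigr => k _.
    by rewrite (max_idPr _)// mulr_ge0// divr_ge0// ltW.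
  apply: eq_Rintegral => s; rewrite inE/= in_itv/= => /andP[s0 _].
  by rewrite (max_idPr s0).
Qed.

Lemma bessel_runmax_law (v : R) : 0 < v ->
  same_law P P' (fun w => runmax (fun t : R => rho (Num.max 0 t) w) v)
                (fun w => runmax (fun t : R => rho' (Num.max 0 t) w) v).
Proof.
move=> v0.
apply: (@bessel_functional_law (fun n => n.+2) (fun n => v / n.+1%:R)
  (fun n x => \big[Num.max/x ord0]_k x k)
  (fun x => runmax (fun t : R => x (Num.max 0 t)) v)).
- by move=> n; rewrite divr_gt0.
- move=> n; have m0 := @measurable_coord 'I_n.+2 R ord0.
  elim: (index_enum _) => [|k s IH].
    by apply: eq_measurable_fun m0 => x _; rewrite big_nil.
  pose G (x : path_space 'I_n.+2 R) : R :=
    Num.max (x k) (\big[Num.max/x ord0]_(i <- s) x i).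
  apply: (eq_measurable_fun G) => [x _|]; first by rewrite big_cons.
  by apply: measurable_maxr => //; exact: measurable_coord.
- move=> x cx; have := grid_max_cvg (continuous_max0 cx) v0.
  apply: cvg_trans; apply: near_eq_cvg; apply: nearW => n.
  rewrite /grid_max /= mul0r maxxx; apply: eq_bigr => k _.
  by rewrite (max_idPr _)// mulr_ge0// divr_ge0// ltW.
Qed.

End bessel_functionals.

(** * The clock as an inverse additive functional *)

Section clock_inverse.
Context (R : realType).
Notation mu := (@lebesgue_measure R).

Lemma exp_pos_part_continuous (c : R) (x : R -> R) : continuous x ->
  continuous (fun s => expR (c * Num.max (x s) 0)).
Proof.
move=> cx s; apply: (@continuous_comp _ _ _ (fun s => c * Num.max (x s) 0) expR).
  apply: cvgM; first exact: cvg_cst.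
  by apply: (@continuous_max R R x (cst 0)); [exact: cx|exact: cvg_cst].
exact: continuous_expR.
Qed.

Lemma continuous_ge_right (r : R -> R) (a : R) : continuous r ->
  (forall t, 0 < t -> a < r t) -> a <= r 0.
Proof.
move=> cr ra; rewrite leNgt; apply/negP => r0a.
have : \forall t \near (0 : R)^'+, r t < a.
  by apply: (cvgr_lt (r 0)) => //; apply: cvg_at_right_filter; exact: cr.
move=> H; have : \forall t \near (0 : R)^'+, False.
  near=> t; have : r t < a by near: t.
  by apply/negP; rewrite -leNgt ltW// ra.
by move=> /filter_ex[].
Unshelve. all: by end_near. Qed.

(** Write H for the clock of [r] and A u for the integral of exp (2 x^+) over
    [0, u].  The change of variables s -> H s gives
    A (H t) = int_0^t exp (2 ln (r s)) / (r s)^2 ds = t, because x = ln r >= 0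
    along the clock, and A is strictly increasing.  The positive part only acts
    at levels that the clock does not see; it ensures A u >= u for every path,
    so that A reaches every level. *)
Lemma clock_lt (r x : R -> R) (t u : R) :
  {within `[0, +oo[%classic, continuous r} ->
  {within `[0, +oo[%classic, continuous x} ->
  (forall s, 0 < s -> 1 < r s) ->
  (forall s, 0 <= s -> ln (r s) = x (\int[mu]_(v in `[0, s]) (r v ^+ 2)^-1)) ->
  0 <= t -> 0 <= u ->
  u < \int[mu]_(v in `[0, t]) (r v ^+ 2)^-1 <->
  \int[mu]_(s in `[0, u]) expR (2 * Num.max (x s) 0) < t.
Proof.
move=> /continuous_max0 cr /continuous_max0 cx r1 rx t0 u0.
set r' := (fun s => r _) in cr; set x' := (fun s => x _) in cx.
have r1' s : 1 <= r' s.
  have r0 : 1 <= r' 0.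
    apply: continuous_ge_right => // y y0; rewrite /r' (max_idPr _) ?r1//.
    exact: ltW.
  have [s0|s0] := leP s 0; first by move: r0; rewrite /r' maxxx (max_idPl _).
  by rewrite /r' (max_idPr _) ltW// r1.
pose q s := (r' s ^+ 2)^-1.
have q0 s : 0 < q s by rewrite invr_gt0 exprn_gt0// (lt_le_trans _ (r1' s)).
have cq : continuous q.
  move=> s; apply: cvgV; first by rewrite gt_eqF// exprn_gt0// (lt_le_trans _ (r1' s)).
  by apply: (@continuous_comp _ _ _ r' (fun y => y ^+ 2)); [exact: cr|exact: exprn_continuous].
pose g s := expR (2 * Num.max (x' s) 0).
have cg : continuous g by exact: exp_pos_part_continuous.
have pE s : 0 <= s -> primitive q s = \int[mu]_(v in `[0, s]) (r v ^+ 2)^-1.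
  move=> s0; rewrite primitiveE//; apply: eq_Rintegral => v.
  by rewrite inE/= in_itv/= => /andP[v0 _]; rewrite /q /r' (max_idPr _).
have p_ge0 s : 0 <= s -> 0 <= primitive q s.
  by move=> s0; rewrite primitiveE//; apply: Rintegral_ge0 => v _; exact: ltW.
have key : \int[mu]_(v in `[0, primitive q t]) g v = t.
  rewrite Rintegral_change_clock//.
  rewrite (@eq_Rintegral _ _ _ _ _ (cst 1)); first by rewrite Rintegral_itv_cst// mul1r subr0.
  move=> s; rewrite inE/= in_itv/= => /andP[s0 _].
  have xE : x' (primitive q s) = ln (r' s).
    rewrite /x' (max_idPr (p_ge0 _ s0)) pE// -rx//.
    by rewrite /r' (max_idPr s0).
  rewrite /g xE (max_idPl _) ?ln_ge0// /q expRM_natl.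
  by rewrite lnK ?posrE ?(lt_le_trans _ (r1' s))// divff// gt_eqF// exprn_gt0// (lt_le_trans _ (r1' s)).
have AE y : 0 <= y -> \int[mu]_(s in `[0, y]) expR (2 * Num.max (x s) 0) = primitive g y.
  move=> y0; rewrite (primitiveE cg y0); apply: eq_Rintegral => s.
  by rewrite inE/= in_itv/= => /andP[s0 _]; rewrite /g /x' (max_idPr s0).
rewrite -(primitiveE cg (p_ge0 _ t0)) in key.
rewrite -(pE _ t0) (AE _ u0) -[X in _ <-> _ < X]key.
have g0 s : 0 < g s by exact: expR_gt0.
split; first by move=> ?; exact: primitive_lt.
move=> lt; rewrite ltNge; apply/negP; rewrite le_eqVlt => /predU1P[e|].
  by move: lt; rewrite e ltxx.
move=> /(primitive_lt cg g0 (p_ge0 _ t0)) /(lt_trans lt); by rewrite ltxx.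
Qed.

(** As g >= 1, the integral has reached the level t / c at time t / c, and the
    crossing point given by the intermediate value theorem is unique. *)
Lemma crossing_time (g : R -> R) (c t : R) : continuous g ->
  (forall s, 1 <= g s) -> 0 < c -> 0 < t ->
  exists T : R, 0 <= T /\
    forall v, 0 <= v -> v < T <-> c * \int[mu]_(s in `[0, v]) g s < t.
Proof.
move=> cg g1 c0 t0.
have g0 s : 0 < g s by exact: lt_le_trans (g1 s).
have pt : t / c <= primitive g (t / c).
  have tc : 0 <= t / c by rewrite divr_ge0// ltW.
  rewrite primitiveE//; apply: le_trans (Rintegral_itv_ge (m := 1) cg tc _) => //.
  by rewrite subr0 mul1r.
have tc0 : 0 <= t / c by rewrite divr_ge0// ltW.
have p0 : primitive g 0 = 0 by rewrite /primitive subrr.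
have cp : {within `[0, t / c], continuous (primitive g)}.
  apply: continuous_in_subspaceT => s; rewrite inE/= in_itv/= => /andP[s0 _].
  by apply: primitive_continuous => //; apply: lt_le_trans s0; rewrite ltrN10.
have [|T] := IVT tc0 cp (v := t / c).
  by rewrite p0 ge_min tc0 le_max pt orbT.
rewrite in_itv/= => /andP[T0 _] TE; exists T; split=> // v v0.
rewrite -primitiveE// mulrC -ltr_pdivlMr// -TE.
split; first by move=> ?; exact: primitive_lt.
move=> lt; rewrite ltNge; apply/negP; rewrite le_eqVlt => /predU1P[e|].
  by move: lt; rewrite e ltxx.
by move=> /(primitive_lt cg g0 T0) /(lt_trans lt); rewrite ltxx.
Qed.

End clock_inverse.

(** * Almost sure properties of Bessel paths *)

Section bessel_paths.
Context d (T : measurableType d) (R : realType) (P : probability T R).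
Variable rho : R -> {RV P >-> R}.
Hypothesis brho : bessel3 rho.

Lemma bessel_start : {ae P, forall w, rho 0 w = 0}.
Proof.
have [_ [d1 [W [Q [B [[bB iB] rhoE]]]]]] := brho.
apply: ae_probability1.
  exact: (measurable_preimage (f := rho 0) (A := [set 0])).
have := rhoE 1%N (fun=> 0) (fun=> [set 0]) (fun=> lexx _) (fun=> measurable_set1 _).
have -> : [set w | forall i : 'I_1, [set 0] (rho 0 w)] = (fun w => rho 0 w = 0).
  by apply/seteqP; split=> w /= => [/(_ ord0)//|].
move=> ->.
rewrite -(@probability_setT _ _ _ Q); apply: ae_eq_probability => //.
  apply: (@measurable_box 'I_1 R _ _ (fun w _ => Num.sqrt (\sum_(k < 3) B k 0 w ^+ 2)) (fun=> [set 0])) => // _.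
  apply: measurableT_comp.
    by apply: continuous_measurable_fun; exact: sqrt_continuous.
  by apply: measurable_sum => k; exact: measurable_funX.
have B0 k : {ae Q, forall w, B k 0 w = 0} by case: (bB k).
have : {ae Q, forall w, [/\ B ord0 0 w = 0, B (lift ord0 ord0) 0 w = 0
     & B (lift ord0 (lift ord0 ord0)) 0 w = 0]}.
  apply: filterS2 (filterI (B0 ord0) (B0 (lift ord0 ord0))) (B0 (lift ord0 (lift ord0 ord0))).
  by move=> w [b0 b1] b2; split.
apply: filterS => w [b0 b1 b2]; split=> // _ _ /=.
by rewrite !big_ord_recl big_ord0 b0 b1 b2 expr0n !addr0 sqrtr0.
Qed.

(** At time m^2 the process is at most 1 only if the first coordinate of the
    Brownian motion lies in [-1, 1], which has probability at most 2 / m since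
    the Gaussian density with standard deviation m is at most 1 / m. *)
Lemma bessel_unbounded : {ae P, forall w, exists2 t, 0 <= t & 1 < rho t w}.
Proof.
have [_ [d1 [W [Q [B [[bB iB] rhoE]]]]]] := brho.
pose tm (n : nat) : R := n.+1%:R ^+ 2.
have tm0 n : 0 < tm n by rewrite exprn_gt0.
have mle n : measurable [set w | rho (tm n) w <= 1].
  have := measurable_preimage (f := rho (tm n)) (measurable_funP _) (measurable_itv `]-oo, 1]).
  by congr measurable; apply/seteqP; split=> w /=; rewrite in_itv.
pose N := \bigcap_n [set w | rho (tm n) w <= 1].
have mN : measurable N by exact: bigcap_measurableType.
have bound n : (P N <= (2 / n.+1%:R)%:E)%E.
  apply: (@le_trans _ _ (P [set w | rho (tm n) w <= 1])).
    by apply: le_measure; rewrite ?inE// => w; exact.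
  have := rhoE 1%N (fun=> tm n) (fun=> `]-oo, 1]%classic) (fun=> ltW (tm0 n)) (fun=> measurable_itv _).
  have -> : [set w | forall i : 'I_1, `]-oo, 1]%classic (rho (tm n) w)] =
      [set w | rho (tm n) w <= 1].
    by apply/seteqP; split=> w /= => [/(_ ord0)|h _]; rewrite in_itv.
  move=> ->.
  have [[_ nB _] B0] := bB ord0.
  have e := nB 0 (tm n) (lexx _) (tm0 n) `[-1, 1]%classic (measurable_itv _).
  apply: (@le_trans _ _ (Q ((fun w => B ord0 (tm n) w - B ord0 0 w) @^-1` `[-1, 1]%classic))).
    have -> : Q ((fun w => B ord0 (tm n) w - B ord0 0 w) @^-1` `[-1, 1]%classic) =
        Q (B ord0 (tm n) @^-1` `[-1, 1]%classic).
      apply: ae_eq_probability.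
      - by apply: measurable_preimage => //; exact: measurable_funB.
      - exact: measurable_preimage.
      - by apply: filterS B0 => w w0 /=; rewrite w0 subr0.
    apply: le_measure; rewrite ?inE.
    - apply: (@measurable_box 'I_1 R _ _ (fun w _ => Num.sqrt (\sum_(k < 3) B k (tm n) w ^+ 2)) (fun=> `]-oo, 1]%classic)) => // _.
      apply: measurableT_comp.
        by apply: continuous_measurable_fun; exact: sqrt_continuous.
      by apply: measurable_sum => k; exact: measurable_funX.
    - exact: measurable_preimage.
    - move=> w /= /(_ ord0); rewrite !in_itv/= => h.
      rewrite -ler_norml -sqrtr_sqr; apply: le_trans h; apply: ler_wsqrtr.
      by rewrite (bigD1 ord0)//= lerDl; apply: sumr_ge0 => k _; exact: sqr_ge0.
  rewrite e subr0 /tm sqrtr_sqr gtr0_norm// /normal_prob.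
  have n0 : n.+1%:R != 0 :> R by [].
  apply: (@le_trans _ _ (\int[lebesgue_measure]_(x in `[(-1)%R, 1%R]) (normal_peak (n.+1%:R : R))%:E)%E).
    apply: ge0_le_integral => //=.
    - by move=> x _; rewrite lee_fin normal_pdf_ge0.
    - by apply/measurable_EFinP; apply: measurable_funTS; exact: measurable_normal_pdf.
    - by move=> x _; rewrite lee_fin normal_pdf_ub.
  rewrite integral_cst//= lebesgue_measure_itv/= lte_fin.
  have -> : -1 < 1 :> R by lra.
  rewrite -EFinD -EFinM lee_fin opprK mulrC ler_wpM2l//.
  rewrite /normal_peak lef_pV2 ?posrE//; last first.
    by rewrite sqrtr_gt0 -mulr_natr !mulr_gt0// ?pi_gt0// exprn_gt0.
  rewrite -[leLHS]gtr0_norm// -sqrtr_sqr; apply: ler_wsqrtr.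
  rewrite -[leRHS]mulr_natr -mulrA ler_peMr ?sqr_ge0//.
  have := @pi_ge2 R; lra.
have PN0 : P N = 0%E.
  apply/eqP; rewrite eq_le measure_ge0 andbT; apply/lee_addgt0Pr => e e0.
  rewrite add0e; apply: le_trans (bound (Num.truncn (2 / e))) _.
  rewrite lee_fin ler_pdivrMr// mulrC -ler_pdivrMr//; exact/ltW/truncnS_gt.
have := ae_probability0 mN PN0; apply: filterS => w /existsNP[n]; rewrite not_implyE => -[_ /negP].
by rewrite -ltNge => h; exists (tm n) => //; exact: ltW.
Qed.

Notation M := (fun v w => runmax (fun t : R => rho (Num.max 0 t) w) v).

Lemma runmax_mono (f : R -> R) (u v : R) : continuous f -> 0 <= u -> u <= v ->
  runmax f u <= runmax f v.
Proof.
move=> cf u0 uv; have [c [/andP[c0 cu] -> _]] := runmax_attained cf u0.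
have [c' [_ -> ]] := runmax_attained cf (le_trans u0 uv); apply.
by rewrite c0 (le_trans cu).
Qed.

Lemma runmax_flat (f : R -> R) (u x v a : R) : continuous f -> 0 <= u ->
  u <= x -> x <= v -> runmax f u = a -> runmax f v = a -> runmax f x = a.
Proof.
move=> cf u0 ux xv fu fv; apply/eqP; rewrite eq_le.
have := runmax_mono cf u0 ux; rewrite fu => ->; rewrite andbT -fv.
by apply: runmax_mono => //; exact: le_trans ux.
Qed.

(** By scaling, the running maximum at time v has an atom at 1 iff the running
    maximum at time 1 has one at 1 / sqrt v, which happens for at most
    countably many v, whereas ]p, q[ is uncountable. *)
Lemma runmax_atom (p q : R) : 0 < p -> p < q ->
  exists v, [/\ p < v, v < q & P [set w | M v w = 1] = 0%E].
Proof.
move=> p0 pq; have [cr _] := brho.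
have scaleM (c : R) w : 0 < c ->
    runmax (fun t : R => scaled c rho (Num.max 0 t) w) 1 = c^-1 * M (c ^+ 2) w.
  move=> c0; have c20 : 0 < c ^+ 2 by rewrite exprn_gt0.
  have cf := continuous_max0 (cr w).
  have cg := continuous_max0 (@continuous_scaled _ _ _ P c rho cr w).
  have [a [/andP[a0 a1] -> aM]] := runmax_attained cf (ltW c20).
  have [b [/andP[b0 b1] -> bM]] := runmax_attained cg ler01.
  rewrite /= in bM *; rewrite (max_idPr b0) (max_idPr a0) in aM bM *.
  apply/eqP; rewrite eq_le; apply/andP; split.
    rewrite ler_pM2l ?invr_gt0//.
    have := aM (c ^+ 2 * b); rewrite (max_idPr _); last by rewrite mulr_ge0// ltW.
    by apply; rewrite mulr_ge0 ?(ltW c20)//= ler_piMr// ltW.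
  have ac0 : 0 <= a / c ^+ 2 by rewrite divr_ge0// ltW.
  have := bM (a / c ^+ 2); rewrite (max_idPr ac0).
  have -> : c ^+ 2 * (a / c ^+ 2) = a by rewrite mulrC divfK// gt_eqF.
  apply.
  by rewrite ac0/= ler_pdivrMr// mul1r.
have mrho t : 0 <= t -> measurable_fun setT (rho t) by [].
have m1 := measurable_runmax mrho cr ltr01.
pose at1 := [set r | 0 < pmf (mfun_of m1 : {RV P >-> R}) r].
have cat : countable at1 by exact: pmf_gt0_countable.
pose S := [set a^-1 ^+ 2 | a in at1].
have cS : countable S := sub_countable (card_image_le _ _) cat.
have [v vpq vS] : exists2 v, v \in `]p, q[ & ~ S v.
  apply: contrapT => H.
  have sub : `]p, q[%classic `<=` S.
    move=> v vpq; apply: contrapT => nS; apply: H; exists v => //.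
  have := countable_lebesgue_measure0 (sub_countable (subset_card_le sub) cS).
  rewrite lebesgue_measure_itv/= lte_fin pq -EFinD => /eqP.
  by rewrite eqe subr_eq0 gt_eqF.
move: vpq; rewrite in_itv/= => /andP[pv vq]; exists v; split => //.
have v0 : 0 < v by exact: lt_trans pv.
pose c := Num.sqrt v; have c0 : 0 < c by rewrite sqrtr_gt0.
have c2 : c ^+ 2 = v by rewrite sqr_sqrtr// ltW.
have := bessel_runmax_law brho (bessel_scaled c0 brho) ltr01.
move=> /(_ _ (measurable_set1 c^-1)).
have -> : (fun w => runmax (fun t : R => scaled c rho (Num.max 0 t) w) 1) @^-1` [set c^-1]
    = [set w | M v w = 1].
  apply/seteqP; split=> w /=; rewrite scaleM// c2.
    by move=> /(congr1 ( *%R c)); rewrite mulVKf ?gt_eqF// divff ?gt_eqF.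
  by move=> ->; rewrite mulr1.
move=> <-; apply: contrapT => H; apply: vS; exists c^-1; last by rewrite invrK.
rewrite /at1 /= /pmf lt_neqAle fine_ge0// andbT eq_sym; apply/eqP => /= h.
apply: H; rewrite -[LHS]fineK ?h//.
apply: fin_num_measure; exact: measurable_preimage.
Qed.

(** A plateau of the running maximum at level 1 contains two consecutive
    multiples of some 1 / (m + 1), and there are countably many such pairs.
    Between the two there is, by [runmax_atom], a fixed time at which the
    running maximum almost surely differs from 1. *)
Lemma bessel_no_flat : {ae P, forall w, forall u v, 0 <= u -> u < v ->
  ~ (M u w = 1 /\ M v w = 1)}.
Proof.
have [cr _] := brho.
have mrho t : 0 <= t -> measurable_fun setT (rho t) by [].
pose p (n m : nat) : R := n.+1%:R / m.+1%:R.
have p0 n m : 0 < p n m by rewrite divr_gt0.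
have pp n m : p n m < p n.+1 m by rewrite ltr_pM2r ?invr_gt0// ltr_nat.
have H n m : {ae P, forall w, ~ (M (p n m) w = 1 /\ M (p n.+1 m) w = 1)}.
  have [v [pv vp Pv]] := runmax_atom (p0 n m) (pp n m).
  have v0 : 0 < v by exact: lt_trans pv.
  have mv : measurable [set w | M v w = 1].
    exact: (measurable_preimage (measurable_runmax mrho cr v0) (measurable_set1 1)).
  apply: filterS (ae_probability0 mv Pv) => w nv [M1 M2]; apply: nv => /=.
  have cf := continuous_max0 (cr w).
  exact: (runmax_flat cf (ltW (p0 n m)) (ltW pv) (ltW vp) M1 M2).
have := ae_forall_nat (fun n => ae_forall_nat (H n)).
apply: filterS => w nf u v u0 uv [Mu Mv].
have cf := continuous_max0 (cr w).
have vu : 0 < v - u by rewrite subr_gt0.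
pose m := Num.truncn (2 / (v - u)).
have m0 : 0 < m.+1%:R :> R by [].
have hm : 2 / m.+1%:R < v - u.
  by rewrite ltr_pdivrMr// mulrC -ltr_pdivrMr//; exact: truncnS_gt.
pose n := Num.truncn (u * m.+1%:R).
have /andP[n1 n2] := truncn_itv (mulr_ge0 u0 (ltW m0)).
have up : u <= p n m by rewrite ler_pdivlMr// ltW.
have pv : p n.+1 m <= v.
  apply/ltW; apply: (@le_lt_trans _ _ (u + 2 / m.+1%:R)); last by rewrite -ltrBrDl.
  rewrite ler_pdivrMr// mulrDl divfK ?gt_eqF//.
  by rewrite -addn2 natrD lerD2r.
have pq := ltW (pp n m).
apply: (nf n m); split.
  exact: (runmax_flat cf u0 up (le_trans pq pv) Mu Mv).
exact: (runmax_flat cf u0 (le_trans up pq) pv Mu Mv).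
Qed.

End bessel_paths.

(** * Hitting times *)

Lemma inf_ge0 (R : realType) (S : set R) : (forall u, S u -> 0 <= u) -> 0 <= inf S.
Proof.
move=> S0; have [S_ne|] := pselect (S !=set0); first exact: lb_le_inf.
by move=> /nonemptyPn ->; rewrite inf0.
Qed.

Section hitting_time_measurable.
Context d (T : measurableType d) (R : realType).
Variable X : R -> T -> R.
Hypothesis mX : forall t, 0 <= t -> measurable_fun setT (X t).
Hypothesis cX : forall w, {within `[0, +oo[%classic, continuous (fun t => X t w)}.

(** The path visits a during [0, v] iff the maximum of - |X - a| over [0, v]
    is 0. *)
Lemma measurable_hit_before (a v : R) : 0 < v ->
  measurable [set w | exists2 u, 0 <= u <= v & X u w = a].
Proof.
move=> v0; pose Y t w := - `|X t w - a|.
have mY t : 0 <= t -> measurable_fun setT (Y t).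
  move=> t0; apply: measurableT_comp => //; apply: measurableT_comp => //.
  by apply: measurable_funB => //; exact: mX.
have cY w : {within `[0, +oo[%classic, continuous (fun t => Y t w)}.
  have cg := continuous_max0 (@cX w).
  apply: (@continuous_within0 _ _ (fun t : R => - `|X (Num.max 0 t) w - a|)).
    move=> t; apply: cvgN; apply: cvg_norm; apply: cvgB; first exact: cg.
    exact: cvg_cst.
  by move=> t t0; rewrite (max_idPr _).
have := measurable_preimage (measurable_runmax mY cY v0) (measurable_set1 0).
congr measurable; apply/seteqP; split=> w /=;
    have [c [cv -> cM]] := runmax_attained (continuous_max0 (@cY w)) (ltW v0);
    have c0 : 0 <= c by case/andP: cv.
  rewrite (max_idPr c0) /Y => /eqP; rewrite oppr_eq0 normr_eq0 subr_eq0 => /eqP.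
  by exists c.
move=> [u uv ua]; have := cM u uv; have u0 : 0 <= u by case/andP: uv.
rewrite (max_idPr c0) (max_idPr u0) /Y ua subrr normr0 oppr0.
by move=> h; apply/eqP; rewrite eq_le h andbT oppr_le0.
Qed.

Lemma measurable_hitting (a : R) :
  measurable_fun setT (fun w => inf [set u : R | 0 <= u /\ X u w = a]).
Proof.
apply: measurable_fun_lt => c.
have lbS w : has_lbound [set u : R | 0 <= u /\ X u w = a].
  by exists 0 => u [].
have ge0 w : 0 <= inf [set u : R | 0 <= u /\ X u w = a].
  by apply: inf_ge0 => u [].
have [c0|c0] := leP c 0.
  rewrite (_ : [set w | _] = set0)//; apply/seteqP; split=> // w /=.
  by move=> /(le_lt_trans (ge0 w)); rewrite ltNge c0.
pose hit v := [set w | exists2 u, 0 <= u <= v & X u w = a].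
(* the infimum is 0 < c when the level is never reached; otherwise it is less
   than c iff the level is reached before some c (n + 1) / (n + 2) *)
rewrite (_ : [set w | _] =
  ~` (\bigcup_n hit n.+1%:R) `|` \bigcup_n hit (c * (n.+1%:R / n.+2%:R))).
  apply: measurableU; [apply: measurableC|]; apply: bigcupT_measurable => n.
    exact: measurable_hit_before.
  by apply: measurable_hit_before; rewrite mulr_gt0// divr_gt0.
apply/seteqP; split=> w /=.
  move=> ic; have [ne|ne] := pselect ([set u : R | 0 <= u /\ X u w = a] !=set0); last first.
    left=> -[n _ [u /andP[u0 _] ua]]; apply: ne; exists u; split => //.
  right; have [v [v0 va] vc] := inf_lt ne ic.
  have cv : 0 < c - v by rewrite subr_gt0.
  exists (Num.truncn (c / (c - v))) => //; exists v => //; rewrite v0/=.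
  have := truncnS_gt (c / (c - v)); set m := _.+1; rewrite ltr_pdivrMr// => h.
  have mE : m.+1%:R = m%:R + 1 :> R by rewrite -natr1.
  rewrite mulrA ler_pdivlMr// mE; nra.
move=> [nh|[n _ [u /andP[u0 un] ua]]].
  rewrite (_ : [set u | _] = set0) ?inf0//.
  apply/seteqP; split=> // u [u0 ua]; apply: nh.
  exists (Num.truncn u) => //; exists u => //.
  by rewrite u0/=; exact/ltW/truncnS_gt.
apply: le_lt_trans (_ : u < c).
  by apply: ge_inf => //; split.
by apply: le_lt_trans un _; rewrite gtr_pMr// ltr_pdivrMr// mul1r ltr_nat.
Qed.

End hitting_time_measurable.

Section hitting_crossing.
Context (R : realType) (x : R -> R).
Hypothesis cx : {within `[0, +oo[%classic, continuous x}.
Hypothesis x0 : x 0 < 1.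
Hypothesis xgt : exists2 t, 0 <= t & 1 < x t.
Notation M := (runmax (fun t : R => x (Num.max 0 t))).
Hypothesis no_flat : forall u v, 0 <= u -> u < v -> ~ (M u = 1 /\ M v = 1).
Let T := inf [set u : R | 0 <= u /\ x u = 1].
Notation mu := (@lebesgue_measure R).

Let cx' : continuous (fun t : R => x (Num.max 0 t)) := continuous_max0 cx.

Let hit v : 0 <= v -> 1 <= x v -> exists u, [/\ 0 <= u, u <= v & x u = 1].
Proof.
move=> v0 xv.
have [|u] := IVT v0 (continuous_subspaceT cx') (v := 1).
  by rewrite maxxx (max_idPr v0) ge_min (ltW x0)/= le_max xv orbT.
rewrite in_itv/= => /andP[u0 uv]; rewrite (max_idPr u0) => xu.
by exists u; split.
Qed.

Let T_le u : 0 <= u -> x u = 1 -> T <= u.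
Proof. by move=> u0 xu; apply: ge_inf => //; exists 0 => v []. Qed.

Let T_ge0 : 0 <= T.
Proof. by apply: inf_ge0 => u []. Qed.

Lemma runmax_before_hitting v : 0 <= v -> v < T -> M v < 1.
Proof.
move=> v0 vT; have [c [/andP[c0 cv] -> _]] := runmax_attained cx' v0.
rewrite (max_idPr c0) ltNge; apply/negP => /(hit c0)[u [u0 uc xu]].
by have := le_lt_trans (le_trans (T_le u0 xu) (le_trans uc cv)) vT; rewrite ltxx.
Qed.

(** From T on the maximum is at least 1; being 1 at v, it would also be 1 at the
    middle of T and v. *)
Lemma runmax_after_hitting v : T < v -> 1 < M v.
Proof.
move=> Tv.
have ge1 y : T < y -> 1 <= M y.
  move=> Ty.
  have [t t0 xt] := xgt; have [s [s0 _ xs]] := hit t0 (ltW xt).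
  have [|u [u0 xu] uy] := inf_lt (S := [set u : R | 0 <= u /\ x u = 1]) _ Ty.
    by exists s; split.
  have y0 := le_trans T_ge0 (ltW Ty).
  have [c [_ -> ]] := runmax_attained cx' y0; move=> /(_ u).
  by rewrite u0 (ltW uy) => /(_ isT); rewrite (max_idPr u0) xu.
have [m Tm mv] : exists2 m, T < m & m < v.
  by exists ((T + v) / 2); rewrite ?midf_lt.
have m0 : 0 <= m by exact: le_trans T_ge0 (ltW Tm).
rewrite lt_neqAle (ge1 _ Tv) andbT eq_sym; apply/eqP => Mv.
apply: (no_flat m0 mv); split => //; apply/eqP; rewrite eq_le (ge1 _ Tm) andbT.
by rewrite -Mv; apply: runmax_mono => //; exact: ltW.
Qed.

(** Laplace's principle.  If the maximum of [x] over [0, v] is less than 1, the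
    integral is at most v exp (2 lam m) with m < 1, which is negligible against
    exp (2 lam) / lam^2.  If the maximum exceeds 1, the path stays above 1 on an
    interval of some length e > 0, and lam^2 e >= 1 for large lam. *)
Lemma inverse_functional_cvg (lam Phi : nat -> R) :
  (forall n, 0 < lam n) -> lam n @[n --> \oo] --> +oo ->
  (forall n, 0 <= Phi n) ->
  (forall n v, 0 <= v -> v < Phi n <->
    lam n ^+ 2 * \int[mu]_(s in `[0, v])
      expR (2 * lam n * Num.max (x (Num.max 0 s)) 0) < expR (2 * lam n)) ->
  Phi n @[n --> \oo] --> T.
Proof.
move=> lam0 lamy Phi0 PhiE.
have cg n : continuous (fun s : R => expR (2 * lam n * Num.max (x (Num.max 0 s)) 0)).
  exact: exp_pos_part_continuous.
have lower v : 0 <= v -> v < T -> \forall n \near \oo, v <= Phi n.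
  move=> v0 vT; have := runmax_before_hitting v0 vT.
  have [c [_ -> cM]] := runmax_attained cx' v0.
  set m' := x _ => m'1; pose m := Num.max m' 0.
  have m1 : 0 < 1 - m by rewrite subr_gt0 /m gt_max m'1 ltr01.
  near=> n; apply/ltW/PhiE => //.
  have l0 := lam0 n.
  have I_le : \int[mu]_(s in `[0, v]) expR (2 * lam n * Num.max (x (Num.max 0 s)) 0)
      <= expR (2 * lam n * m) * v.
    rewrite -[in leRHS](subr0 v); apply: Rintegral_itv_le => // s sv.
    rewrite ler_expR ler_wpM2l ?mulr_ge0// ?(ltW l0)//.
    by rewrite /m ge_max !le_max lexx orbT cM.
  apply: (@le_lt_trans _ _ (lam n ^+ 2 * (expR (2 * lam n * m) * v))).
    by rewrite ler_wpM2l// sqr_ge0.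
  have -> : expR (2 * lam n) = expR (2 * lam n * (1 - m)) * expR (2 * lam n * m).
    by rewrite -expRD; congr expR; ring.
  rewrite mulrA mulrAC ltr_pM2r ?expR_gt0//.
  (* the cubic term of the exponential beats lam^2 *)
  have y0 : 0 <= 2 * lam n * (1 - m) by rewrite !mulr_ge0// ltW.
  apply: lt_le_trans (expR_ge1Dxn 2 y0).
  apply: (@lt_le_trans _ _ ((2 * lam n * (1 - m)) ^+ 3 / (3)`!%:R)); last by rewrite lerDr.
  rewrite ltr_pdivlMr// !exprMn [lam n ^+ 3]exprS.
  have -> : lam n ^+ 2 * v * 3`!%:R = lam n ^+ 2 * (v * 3`!%:R) by rewrite mulrA.
  have -> : 2 ^+ 3 * (lam n * lam n ^+ 2) * (1 - m) ^+ 3 =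
     lam n ^+ 2 * (lam n * (2 ^+ 3 * (1 - m) ^+ 3)) by ring.
  rewrite ltr_pM2l ?exprn_gt0// -ltr_pdivrMr ?mulr_gt0 ?exprn_gt0//.
  by near: n; apply: cvgry_gt.
have upper v : T < v -> \forall n \near \oo, Phi n <= v.
  move=> Tv; have v0 : 0 <= v by exact: le_trans T_ge0 (ltW Tv).
  have := runmax_after_hitting Tv.
  have [c [/andP[c0 cv] -> _]] := runmax_attained cx' v0; rewrite (max_idPr c0) => xc.
  have c_gt0 : 0 < c.
    rewrite lt_neqAle c0 andbT; apply/eqP => c0E.
    by move: xc; rewrite -c0E ltNge (ltW x0).
  have [e [e0 ec xe]] : exists e, [/\ 0 < e, e <= c &
      forall s, c - e <= s <= c -> 1 <= x (Num.max 0 s)].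
    have := cvgr_gt _ (@cx' c); rewrite (max_idPr c0) => /(_ _ _ xc) [/= e e0 eU].
    exists (Num.min (e / 2) c); split.
    - by rewrite lt_min c_gt0 divr_gt0.
    - by rewrite ge_min lexx orbT.
    - move=> s /andP[s1 s2]; apply/ltW/eU => /=.
      rewrite ger0_norm ?subr_ge0// ltrBlDr -ltrBlDl.
      apply: lt_le_trans s1; rewrite ltrD2l ltrN2 gt_min.
      by rewrite ltr_pdivrMr// mulr_natr mulr2n ltrDl e0.
  (* it is enough that lam >= 1 and lam >= 1 / e *)
  near=> n; rewrite leNgt; apply/negP => /(PhiE n v v0); apply/negP; rewrite -leNgt.
  have ce : 0 <= c - e by rewrite subr_ge0.
  have cec : c - e <= c by rewrite lerBlDr lerDl ltW.
  rewrite (Rintegral_itv_split (cg n) ce (le_trans cec cv)).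
  rewrite (Rintegral_itv_split (cg n) cec cv).
  apply: (@le_trans _ _ (lam n ^+ 2 * (expR (2 * lam n) * (c - (c - e))))).
    rewrite subKr mulrCA ler_peMr ?expR_ge0//.
    rewrite -ler_pdivrMr// mul1r.
    apply: (@le_trans _ _ (lam n)).
      by near: n; exact: cvgry_ge.
    rewrite expr2 ler_peMr ?(ltW (lam0 n))//.
    by near: n; exact: cvgry_ge.
  rewrite ler_wpM2l ?sqr_ge0//.
  apply: (@le_trans _ _ (\int[mu]_(s in `[c - e, c]) expR (2 * lam n * Num.max (x (Num.max 0 s)) 0))).
    apply: Rintegral_itv_ge => // s sc.
    rewrite ler_expR ler_peMr// ?mulr_ge0// ?(ltW (lam0 n))//.
    by rewrite le_max xe.
  rewrite addrCA lerDl addr_ge0//; apply: Rintegral_ge0 => s _; exact: expR_ge0.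
apply/cvgrPdist_le => e e0.
have low : \forall n \near \oo, T - e <= Phi n.
  have [Te|Te] := leP (T - e) 0.
    by apply: nearW => n; exact: le_trans (Phi0 n).
  by apply: lower; [exact: ltW|rewrite gtrBl].
near=> n; rewrite ler_distlC; apply/andP; split; first by near: n.
by near: n; apply: upper; rewrite ltrDl.
Unshelve. all: by end_near. Qed.

End hitting_crossing.

(** * The rescaled clock *)

Section clock_measurable.
Context d (T : measurableType d) (R : realType) (X : R -> T -> R).
Hypothesis mX : forall t, 0 <= t -> measurable_fun setT (X t).
Hypothesis cX : forall w, {within `[0, +oo[%classic, continuous (fun t => X t w)}.

Lemma measurable_clock (t : R) : measurable_fun setT
  (fun w => \int[lebesgue_measure]_(s in `[0, t]) (X s w ^+ 2)^-1).
Proof.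
apply: (measurable_time_integral mX cX (phi := fun y => (y ^+ 2)^-1)).
  by apply: measurableT_comp (@measurable_invr R) _; exact: measurable_funX.
by move=> y; rewrite invr_ge0 sqr_ge0.
Qed.

End clock_measurable.

Lemma clock_ge0 d (T : measurableType d) (R : realType) (P : probability T R)
    (Rt : R -> {RV P >-> R}) t w : 0 <= clock Rt t w.
Proof. by apply: Rintegral_ge0 => s _; rewrite invr_ge0 sqr_ge0. Qed.

Section coupling.
Context d (T : measurableType d) d' (T' : measurableType d') (R : realType).
Context (P : probability T R) (P' : probability T' R).
Variables (Rt rho : R -> {RV P >-> R}) (rho' : R -> {RV P' >-> R}).
Hypothesis cR : continuous_paths Rt.
Hypothesis R_gt1 : {ae P, forall w, forall t : R, 0 < t -> 1 < Rt t w}.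
Hypothesis hrho : log_time_change rho Rt.
Hypothesis brho' : bessel3 rho'.
Notation mu := (@lebesgue_measure R).

(** [clock_lt] expresses the event through the integral of exp (2 rho^+) up to
    time lam^2 v; dilating time turns it into an integral up to v along the
    rescaled process, which is again a Bessel process. *)
Lemma clock_survival (t v : R) : 1 < t -> 0 <= v ->
  P [set w | v < 4 / (ln t) ^+ 2 * clock Rt t w] =
  P' [set w | (ln t / 2) ^+ 2 * \int[mu]_(s in `[0, v])
     expR (2 * (ln t / 2) * Num.max (rho' s w) 0) < expR (2 * (ln t / 2))].
Proof.
move=> t1 v0; have [brho rhoE] := hrho.
have [crho _] := brho; have [crho' _] := brho'.
set lam := ln t / 2.
have t0 : 0 < t by exact: lt_trans t1.
have lam0 : 0 < lam by rewrite divr_gt0// ln_gt0.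
have lam20 : 0 < lam ^+ 2 by rewrite exprn_gt0.
have cphi c : continuous (fun y : R => expR (c * Num.max y 0)).
  by apply: exp_pos_part_continuous => y; exact: cvg_id.
have mphi c : measurable_fun setT (fun y : R => expR (c * Num.max y 0)).
  exact: continuous_measurable_fun.
have phi_ge0 c (y : R) : 0 <= expR (c * Num.max y 0) by exact: expR_ge0.
have tE : expR (2 * lam) = t by rewrite mulrC divfK// lnK.
have mrho s : 0 <= s -> measurable_fun setT (rho s) by [].
have mR s : 0 <= s -> measurable_fun setT (Rt s) by [].
rewrite tE.
transitivity (P [set w | \int[mu]_(s in `[0, lam ^+ 2 * v])
    expR (2 * Num.max (rho s w) 0) < t]).
  apply: ae_eq_probability.
  - apply: measurable_gt; apply: measurable_funM => //.
    exact: (measurable_clock mR cR).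
  - apply: measurable_lt.
    exact: (measurable_time_integral mrho crho (phi := fun y => expR (2 * Num.max y 0))).
  - move: R_gt1 rhoE; apply: filterS2 => w Rw rw.
    have := @clock_lt R (fun s => Rt s w) (fun s => rho s w) t (lam ^+ 2 * v)
      (@cR w) (crho w) Rw (fun s s0 => rw s s0) (ltW t0).
    move=> /(_ (mulr_ge0 (sqr_ge0 _) v0)) H.
    have lE : 4 / ln t ^+ 2 = (lam ^+ 2)^-1.
      by rewrite /lam; field; rewrite gt_eqF// ln_gt0.
    by rewrite /= lE ltr_pdivlMl.
transitivity (P [set w | lam ^+ 2 * \int[mu]_(s in `[0, v])
    expR (2 * lam * Num.max (scaled lam rho s w) 0) < t]).
  suff dil w : \int[mu]_(s in `[0, lam ^+ 2 * v]) expR (2 * Num.max (rho s w) 0) =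
      lam ^+ 2 * \int[mu]_(s in `[0, v]) expR (2 * lam * Num.max (scaled lam rho s w) 0).
    by congr (P _); apply/seteqP; split=> w /=; rewrite dil.
  pose g (s : R) := expR (2 * Num.max (rho (Num.max 0 s) w) 0).
  have cg : continuous g.
    by apply: exp_pos_part_continuous; exact: continuous_max0 (crho w).
  transitivity (\int[mu]_(s in `[0, lam ^+ 2 * v]) g s).
    apply: eq_Rintegral => s; rewrite inE/= in_itv/= => /andP[s0 _].
    by rewrite /g (max_idPr s0).
  rewrite (Rintegral_itv_dilate cg (fun y => expR_ge0 _) lam20 v0).
  congr (_ * _); apply: eq_Rintegral => s; rewrite inE/= in_itv/= => /andP[s0 _].
  rewrite /g (max_idPr (mulr_ge0 (ltW lam20) s0)); congr expR.
  have e : lam * Num.max (scaled lam rho s w) 0 = Num.max (rho (lam ^+ 2 * s) w) 0.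
    by rewrite maxr_pMr ?(ltW lam0)// mulr0 /= mulVKf ?gt_eqF.
  by rewrite -mulrA e.
(* at v = 0 the integrals vanish and both events are certain *)
move: v0; rewrite le_eqVlt => /predU1P[<-|v0].
  have e d0 (T0 : measurableType d0) (X : T0 -> R -> R) :
      [set w | lam ^+ 2 * \int[mu]_(s in `[0, 0]) X w s < t] = setT.
    by apply/seteqP; split=> // w _ /=; rewrite set_itv1 Rintegral_set1 mulr0.
  by rewrite !e !probability_setT.
have := bessel_integral_law (bessel_scaled lam0 brho) brho' (cphi (2 * lam)) (phi_ge0 _) v0.
move=> /(_ _ (measurable_itv `]-oo, (t / lam ^+ 2)[)).
by congr (P _ = P' _); apply/seteqP; split=> w /=; rewrite in_itv/= ltr_pdivlMr// mulrC.
Qed.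

(** The rescaled clock has the law of a functional of [rho'] alone, which makes
    almost sure convergence available. *)
Lemma clock_coupling (t : nat -> R) : (forall n, 1 < t n) ->
  t n @[n --> \oo] --> +oo ->
  exists Phi : nat -> T' -> R,
    [/\ forall n, measurable_fun setT (Phi n),
        forall n w, 0 <= Phi n w,
        forall n, same_law P P' (fun w => 4 / (ln (t n)) ^+ 2 * clock Rt (t n) w) (Phi n)
      & {ae P', forall w, Phi n w @[n --> \oo] --> hitting_time rho' 1 w}].
Proof.
move=> t1 ty; have [crho' _] := brho'.
pose lam n := ln (t n) / 2.
have lam0 n : 0 < lam n by rewrite divr_gt0// ln_gt0.
have lamy : lam n @[n --> \oo] --> +oo.
  apply/cvgryPge => A; near=> n.
  rewrite ler_pdivlMr// -ler_expR lnK ?posrE ?(lt_trans ltr01)//.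
  by near: n; exact: cvgry_ge.
pose g n w (s : R) := expR (2 * lam n * Num.max (rho' (Num.max 0 s) w) 0).
have cg n w : continuous (g n w).
  by apply: exp_pos_part_continuous; exact: continuous_max0 (crho' w).
have g1 n w s : 1 <= g n w s.
  rewrite /g -[leLHS]expR0 ler_expR; apply: mulr_ge0.
    by rewrite mulr_ge0// ltW.
  by rewrite le_max lexx orbT.
have ex n w := crossing_time (cg n w) (g1 n w) (exprn_gt0 2 (lam0 n)) (expR_gt0 (2 * lam n)).
pose Phi n w := sval (cid (ex n w)).
have Phi0 n w : 0 <= Phi n w := (svalP (cid (ex n w))).1.
have PhiE n w v : 0 <= v -> v < Phi n w <->
    lam n ^+ 2 * \int[mu]_(s in `[0, v]) g n w s < expR (2 * lam n).
  exact: (svalP (cid (ex n w))).2.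
have gE n w v : \int[mu]_(s in `[0, v]) g n w s =
    \int[mu]_(s in `[0, v]) expR (2 * lam n * Num.max (rho' s w) 0).
  apply: eq_Rintegral => s; rewrite inE/= in_itv/= => /andP[s0 _].
  by rewrite /g (max_idPr s0).
have mrho' s : 0 <= s -> measurable_fun setT (rho' s) by [].
have PhiS n v : 0 <= v -> [set w | v < Phi n w] = [set w | lam n ^+ 2 *
    \int[mu]_(s in `[0, v]) expR (2 * lam n * Num.max (rho' s w) 0) < expR (2 * lam n)].
  by move=> v0; apply/seteqP; split=> w /=; rewrite -gE => /PhiE; exact.
have mPhi n : measurable_fun setT (Phi n).
  apply: measurable_fun_gt => // v v0; rewrite PhiS//.
  apply: measurable_lt; apply: measurable_funM => //.
  apply: (measurable_time_integral mrho' crho' (phi := fun y => expR (2 * lam n * Num.max y 0))).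
    apply: continuous_measurable_fun.
    by apply: exp_pos_part_continuous => y; exact: cvg_id.
  by move=> y; exact: expR_ge0.
exists Phi; split=> //.
- move=> n; apply: same_law_gt => //.
    apply: measurable_funM => //.
    by apply: (measurable_clock (X := Rt) _ cR).
  move=> v; have [v0|v0] := leP 0 v.
    by rewrite clock_survival// PhiS.
  have e d0 (T0 : measurableType d0) (X : T0 -> R) : (forall w, 0 <= X w) ->
      [set w | v < X w] = setT.
    by move=> X0; apply/seteqP; split=> // w _ /=; exact: lt_le_trans (X0 w).
  rewrite !e ?probability_setT// => w.
  by rewrite mulr_ge0 ?divr_ge0 ?sqr_ge0// clock_ge0.
- apply: filterS3 (bessel_start brho') (bessel_unbounded brho')
    (bessel_no_flat brho') => w w0 wgt nf.
  apply: (@inverse_functional_cvg R (fun s => rho' s w) (crho' w) _ wgt nf lam (Phi ^~ w)) => //.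
    by rewrite w0 ltr01.
  by move=> n v v0; exact: PhiE.
Unshelve. all: by end_near. Qed.

End coupling.

(** * Mixing over an independent time *)

Section independent_fubini.
Context d1 (E1 : measurableType d1) d2 (E2 : measurableType d2) (R : realType).

Lemma bounded_product_integrable (m1 : probability E1 R) (m2 : probability E2 R)
    (F : E1 * E2 -> R) (M : R) :
  measurable_fun setT F -> (forall p, `|F p| <= M) ->
  (m1 \x m2)%E.-integrable setT (EFin \o F).
Proof.
move=> mF FM; apply/integrable12ltyP; first exact/measurable_EFinP.
apply: (@le_lt_trans _ _ (\int[m1]_x \int[m2]_y (cst M%:E) y)%E).
  apply: ge0_le_integral => //.
  - by move=> x _; exact: integral_ge0.
  - apply: (measurable_fun_fubini_tonelli_F (m2 := m2) (fun p => `|(F p)%:E|)%E) => //.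
    by apply: measurableT_comp => //; exact/measurable_EFinP.
  - move=> x _; apply: ge0_le_integral => //.
    + apply: measurableT_comp => //; apply/measurable_EFinP.
      exact: measurableT_comp (measurable_pair1 _).
    + by move=> y _; rewrite /= lee_fin.
under eq_integral do rewrite integral_cst//= probability_setT mule1.
by rewrite integral_cst//= probability_setT mule1 ltry.
Qed.

Lemma measurable_fun_mix (m1 : probability E1 R) (F : E1 * E2 -> R) (M : R) :
  measurable_fun setT F -> (forall p, `|F p| <= M) ->
  measurable_fun setT (fun y => \int[m1]_x F (x, y)).
Proof.
move=> mF FM; rewrite /Rintegral; apply: measurableT_comp => //.
have [y0|noy] := pselect (exists y0 : E2, True); last first.
  by move=> _ A mA; rewrite (_ : _ `&` _ = set0)//; apply/seteqP; split=> // y; case: noy; exists y.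
have [y _] := y0.
(* any finite measure on the second factor gives access to Fubini's theorem *)
have := @bounded_product_integrable m1 (dirac y : probability E2 R) F M mF FM.
exact: measurable_fubini_G.
Qed.

(** By independence, (U, V) carries P to the product of the laws of U and V. *)
Lemma independent_fubini d (T : measurableType d) (P : probability T R)
    (U : T -> E1) (V : T -> E2) (F : E1 * E2 -> R) (M : R) :
  measurable_fun setT U -> measurable_fun setT V ->
  (forall A B, measurable A -> measurable B ->
    P (U @^-1` A `&` V @^-1` B) = (P (U @^-1` A) * P (V @^-1` B))%E) ->
  measurable_fun setT F -> (forall p, `|F p| <= M) ->
  \int[P]_w F (U w, V w) = \int[P]_w' \int[P]_w F (U w, V w').
Proof.
move=> mU mV UV mF FM.
have mUV : measurable_fun setT (fun w => (U w, V w)) by exact: measurable_fun_pair.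
pose m1 := distribution P (mfun_of mU); pose m2 := distribution P (mfun_of mV).
pose m := distribution P (mfun_of mUV).
have mE X : measurable X -> (m1 \x m2)%E X = m X.
  apply: product_measure_unique => A B mA mB; rewrite -UV//.
have iF := @bounded_product_integrable m1 m2 F M mF FM.
have mF' : measurable_fun setT (EFin \o F) by exact/measurable_EFinP.
rewrite {1}/Rintegral.
transitivity (fine (\int[m]_p (F p)%:E)%E).
  congr fine; rewrite integral_pushforward//.
  apply: (@bounded_integrable _ _ _ P (fun w => F (U w, V w)) M) => [|w].
    exact: measurableT_comp mF mUV.
  exact: FM.
transitivity (fine (\int[(m1 \x m2)%E]_p (F p)%:E)%E).
  by congr fine; apply: eq_measure_integral => A mA _; exact/esym/mE.
rewrite -(integral21_prod_meas1 iF) /Rintegral; congr fine.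
have mG := measurable_fubini_G iF.
have FyM (y : E2) x : `|F (x, y)| <= M by [].
have mFy y : measurable_fun setT (fun x => F (x, y)).
  exact: measurableT_comp (measurable_pair2 _).
have iFU y : P.-integrable setT (fun w => (F (U w, y))%:E).
  apply: (@bounded_integrable _ _ _ P (fun w => F (U w, y)) M) => [|w].
    exact: (measurableT_comp (mFy y) mU).
  exact: FM.
have inner y : (\int[m1]_x (F (x, y))%:E = \int[P]_w (F (U w, y))%:E)%E.
  rewrite integral_pushforward//; [exact/measurable_EFinP|exact: iFU].
have innerfin y : (\int[P]_w (F (U w, y))%:E)%E \is a fin_num.
  by apply: integrable_fin_num => //; exact: iFU.
rewrite integral_pushforward//.
  by apply: eq_integral => w _ /=; rewrite fineK ?innerfin// -inner.
have -> : (fubini_G m1 (EFin \o F) \o mfun_of mV) = EFin \o (fun w' => \int[m1]_x F (x, V w')).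
  apply/funext => w /=; rewrite /fubini_G /= inner /Rintegral inner fineK//.
apply: (@bounded_integrable _ _ _ P _ M).
  exact: (measurableT_comp (@measurable_fun_mix m1 F M mF FM) mV).
by move=> w; apply: Rintegral_bounded => //; exact: measurable_funTS.
Qed.

End independent_fubini.

(** The identity maps from the sample space to itself with the sigma-algebras of
    X and of Y are independent random variables; apply Fubini's theorem to
    f (X (tau w') w), which is jointly measurable for these two
    sigma-algebras. *)
Lemma expectation_independent_time d (T : measurableType d) (R : realType)
    (P : probability T R) (X Y : R -> {RV P >-> R}) (tau : T -> R)
    (f : R -> R) (M : R) :
  continuous_paths X -> independent_processes X Y ->
  measurable_fun setT (tau : history Y -> R) -> (forall w, 0 <= tau w) ->
  measurable_fun setT f -> (forall x, `|f x| <= M) ->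
  \int[P]_w f (X (tau w) w) = \int[P]_w \int[P]_w' f (X (tau w) w').
Proof.
move=> cX iXY mtau tau0 mf fM.
pose F (p : history X * history Y) : R := f (X (Num.max 0 (tau p.2)) p.1).
have mF : measurable_fun setT F.
  apply: measurableT_comp => //.
  have mj := @measurable_joint _ (history X) R (fun t => X t) (@history_measurable _ _ _ _ X) cX.
  have mp : measurable_fun setT
      (fun p : history X * history Y => (tau p.2, p.1) : R * history X).
    apply: measurable_fun_pair; last exact: measurable_fst.
    exact: (measurableT_comp mtau measurable_snd).
  exact: (measurableT_comp mj mp).
have mid (Z : R -> {RV P >-> R}) : measurable_fun setT (fun w : T => (w : history Z)).
  move=> _ A mA; rewrite setTI; exact: (@sigma_process_sub _ _ _ P Z `[0, +oo[%classic).
have := @independent_fubini _ (history X) _ (history Y) R _ T P (fun w => w) (fun w => w) F M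
  (mid X) (mid Y) _ mF (fun p => fM _).
rewrite /F; under eq_Rintegral do rewrite /= (max_idPr (tau0 _)).
move=> ->; last by move=> A B mA mB; exact: iXY.
by apply: eq_Rintegral => w _; rewrite /= (max_idPr (tau0 _)).
Qed.

Section brownian_mix.
Context d (T : measurableType d) d' (T' : measurableType d') (R : realType).
Context (P : probability T R) (P' : probability T' R).
Variables (alpha : R -> {RV P >-> R}) (alpha' : R -> {RV P' >-> R}).
Hypotheses (balpha : brownian_motion alpha) (balpha' : brownian_motion0 alpha').

Lemma brownian_increment_law (c u : R) : 0 < c -> 0 <= u ->
  same_law P P' (fun w => c^-1 * (alpha (c ^+ 2 * u) w - alpha 0 w)) (alpha' u).
Proof.
move=> c0; have [_ nB _] := balpha; have [[_ nB' _] B'0] := balpha'.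
have mc (A : set R) : measurable A -> measurable ((fun x : R => c^-1 * x) @^-1` A).
  by move=> mA; apply: measurable_preimage => //; exact: measurable_funM.
rewrite le_eqVlt => /predU1P[<-|u0] A mA.
  transitivity (P' [set w | A 0]).
    rewrite mulr0 (_ : _ @^-1` A = [set w | A 0]); last first.
      by apply/seteqP; split=> w /=; rewrite subrr mulr0.
    exact: probability_cst_event.
  apply: ae_eq_probability.
  - exact: measurable_cst_event.
  - exact: measurable_preimage.
  - by apply: filterS B'0 => w w0; rewrite /= w0.
have c20 : 0 < c ^+ 2 by rewrite exprn_gt0.
have := nB 0 (c ^+ 2 * u) (lexx _) (mulr_gt0 c20 u0) _ (mc _ mA).
rewrite subr0 (sqrtrM u (ltW c20)) sqrtr_sqr (gtr0_norm c0) normal_prob_scale ?sqrtr_gt0//.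
move=> eP; apply: (etrans eP).
have := nB' 0 u (lexx _) u0 A mA; rewrite subr0 => <-.
apply: ae_eq_probability.
- by apply: measurable_preimage => //; exact: measurable_funB.
- exact: measurable_preimage.
- by apply: filterS B'0 => w w0; rewrite /= w0 subr0.
Qed.

(** The starting point is independent of the rescaled increment, and the latter
    has the law of alpha' at time u. *)
Lemma expectation_brownian_split (c u M : R) (f : R -> R) : 0 < c -> 0 <= u ->
  measurable_fun setT f -> (forall x, `|f x| <= M) ->
  \int[P]_w f (c^-1 * alpha (c ^+ 2 * u) w) =
  \int[P]_w \int[P']_w' f (c^-1 * alpha 0 w + alpha' u w').
Proof.
move=> c0 u0 mf fM; have [_ _ iB] := balpha.
pose U w := c^-1 * (alpha (c ^+ 2 * u) w - alpha 0 w).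
have mU : measurable_fun setT U by apply: measurable_funM => //; exact: measurable_funB.
have law := brownian_increment_law c0 u0.
pose F (p : R * R) : R := f (c^-1 * p.2 + p.1).
have mF : measurable_fun setT F.
  apply: measurableT_comp => //; apply: measurable_funD; last exact: measurable_fst.
  by apply: measurable_funM => //; exact: measurable_snd.
have indep A B : measurable A -> measurable B ->
    P (U @^-1` A `&` alpha 0 @^-1` B) = (P (U @^-1` A) * P (alpha 0 @^-1` B))%E.
  move=> mA mB; rewrite setIC muleC.
  move: u0; rewrite le_eqVlt => /predU1P[u0|u0].
    have UA : U @^-1` A = [set w | A 0].
      by apply/seteqP; split=> w /=; rewrite /U -u0 mulr0 subrr mulr0.
    by rewrite UA independent_cst_event.
  have cu : 0 < c ^+ 2 * u by rewrite mulr_gt0 ?exprn_gt0.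
  apply: (iB 0 _ (lexx _) cu).
    apply: sub_sigma_algebra; exists 0; first by rewrite /= in_itv/= lexx.
    by exists B; rewrite ?setTI.
  exists ((fun x => c^-1 * x) @^-1` A); rewrite ?setTI//.
  by apply: measurable_preimage => //; exact: measurable_funM.
have := @independent_fubini _ R _ R R _ T P U (alpha 0) F M mU _ indep mF (fun p => fM _).
rewrite /F /=; under eq_Rintegral do
  rewrite /U mulrBr addrC subrK.
move=> ->//; apply: eq_Rintegral => w _.
apply: (same_law_int (f := fun y => f (c^-1 * alpha 0 w + y)) (M := M) mU _ _ _ law) => //.
by apply: measurableT_comp => //; exact: measurable_funD.
Qed.

Lemma brownian_split_regular (k M : R) (f : R -> R) :
  measurable_fun setT f -> (forall x, `|f x| <= M) ->
  let G u := \int[P]_w \int[P']_w' f (k * alpha 0 w + alpha' (Num.max 0 u) w') in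
  measurable_fun setT G /\ (forall u, `|G u| <= M).
Proof.
move=> mf fM G; have [[cB _ _] _] := balpha'.
pose F (p : T' * (T * R)) : R :=
  f (k * alpha 0 p.2.1 + alpha' (Num.max 0 p.2.2) p.1).
have mF : measurable_fun setT F.
  apply: measurableT_comp => //; apply: measurable_funD.
    apply: measurable_funM => //; apply: measurableT_comp => //.
    exact: (measurableT_comp measurable_fst measurable_snd).
  have mj := @measurable_joint _ T' R (fun t => alpha' t) (fun t _ => measurable_funP _) cB.
  have mp : measurable_fun setT (fun p : T' * (T * R) => (p.2.2, p.1) : R * T').
    apply: measurable_fun_pair; last exact: measurable_fst.
    exact: (measurableT_comp measurable_snd measurable_snd).
  exact: (measurableT_comp mj mp).
pose K (q : T * R) : R := \int[P']_w' F (w', q).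
have mK : measurable_fun setT K.
  exact: (@measurable_fun_mix _ T' _ (T * R)%type R P' F M mF (fun p => fM _)).
have KM q : `|K q| <= M.
  apply: Rintegral_bounded => [|w]; last exact: fM.
  exact: (measurableT_comp mF (measurable_pair2 q)).
split; first exact: (@measurable_fun_mix _ T _ R R P K M mK KM).
move=> u; apply: (@Rintegral_bounded _ _ _ _ (fun w => K (w, u))) => //.
exact: (measurableT_comp mK (measurable_pair2 u)).
Qed.

(** Dominated convergence twice: in the inner integral the argument converges
    to alpha' v by path continuity, whatever the starting point. *)
Lemma expectation_brownian_split_cvg (c u : nat -> R) (v M : R) (f : R -> R) :
  (forall n, 0 < c n) -> c n @[n --> \oo] --> +oo ->
  (forall n, 0 <= u n) -> u n @[n --> \oo] --> v ->
  continuous f -> (forall x, `|f x| <= M) ->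
  \int[P]_w \int[P']_w' f ((c n)^-1 * alpha 0 w + alpha' (u n) w')
    @[n --> \oo] --> \int[P']_w' f (alpha' v w').
Proof.
move=> c0 cy u0 uv cf fM.
have mf : measurable_fun setT f by exact: continuous_measurable_fun.
have v0 : 0 <= v.
  rewrite -(cvg_lim (@Rhausdorff R) uv); apply: limr_ge; first exact: cvgP uv.
  exact: nearW.
have [[cB _ _] _] := balpha'.
have mF n (y : R) : measurable_fun setT (fun w' => f (y + alpha' (u n) w')).
  by apply: measurableT_comp => //; exact: measurable_funD.
have mG n : measurable_fun setT (fun y : R => \int[P']_w' f (y + alpha' (u n) w')).
  apply: (@measurable_fun_mix _ T' _ R R P' (fun p => f (p.2 + alpha' (u n) p.1)) M) => //.
  apply: measurableT_comp => //; apply: measurable_funD; first exact: measurable_snd.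
  by apply: measurableT_comp => //; exact: measurable_fst.
have cvi : (c n)^-1 @[n --> \oo] --> (0 : R).
  by apply/gtr0_cvgV0; [exact: nearW|].
have -> : \int[P']_w' f (alpha' v w') = \int[P]_w \int[P']_w' f (alpha' v w').
  have P1 : fine (P setT) = 1 by rewrite probability_setT.
  by rewrite Rintegral_cst// P1 mulr1.
apply: (@bounded_cvg _ _ _ P _ _ M).
- move=> n; apply: (measurableT_comp (mG n)); exact: measurable_funM.
- exact: measurable_cst.
- by move=> n w; apply: Rintegral_bounded.
- apply: aeW => w; apply: (@bounded_cvg _ _ _ P' _ _ M) => //.
  + exact: measurableT_comp.
  + apply: aeW => w'; apply: (@continuous_cvg _ _ _ _ _ _ f); first exact: cf.
    rewrite -[X in _ --> X]add0r; apply: cvgD.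
      rewrite -[X in _ --> X](mul0r (alpha 0 w)); apply: cvgM => //; exact: cvg_cst.
    have := @continuous_cvg _ _ _ _ eventually_filter u
      (fun t : R => alpha' (Num.max 0 t) w') v (@continuous_max0 R _ (cB w') v) uv.
    rewrite /= (max_idPr v0); apply: cvg_trans; apply: near_eq_cvg.
    by apply: nearW => n /=; rewrite (max_idPr (u0 n)).
Qed.

End brownian_mix.

(** * Convergence in law of the clock and of the winding *)

(** Dominated convergence is a statement on sequences; times above 1 keep log t
    positive. *)
Lemma cvg_pinfty_gt1P (R : realType) (F : R -> R) (l : R) :
  (forall t : nat -> R, (forall n, 1 < t n) -> t n @[n --> \oo] --> +oo ->
    F (t n) @[n --> \oo] --> l) ->
  F x @[x --> +oo] --> l.
Proof.
move=> H; apply/cvg_pinftyP => u uy.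
pose t n := if 1 < u n then u n else 2.
have tE : \forall n \near \oo, t n = u n.
  near=> n; rewrite /t; have -> // : 1 < u n by near: n; exact: cvgry_gt.
have t1 n : 1 < t n by rewrite /t; case: ifP => // _; rewrite ltr1n.
have ty : t n @[n --> \oo] --> +oo.
  by apply: cvg_trans uy; apply: near_eq_cvg; apply: filterS tE => n.
apply: cvg_trans (H t t1 ty); apply: near_eq_cvg.
by apply: filterS tE => n ->.
Unshelve. all: by end_near. Qed.

Theorem theorem2p3p1 (R : realType)
  (d : measure_display) (T : measurableType d) (P : probability T R)
  (beta Rt rho alpha : R -> {RV P >-> R})
  (hR : radial_SDE beta Rt)
  (hrho : log_time_change rho Rt)
  (halpha : brownian_motion alpha)
  (hind : independent_processes alpha Rt)
  (d' : measure_display) (T' : measurableType d') (P' : probability T' R)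
  (rho' : R -> {RV P' >-> R})
  (hrho' : bessel3 rho') :
  cvg_in_law P P' (fun t w => 4 / (ln t) ^+ 2 * clock Rt t w)
    (hitting_time rho' 1)
  /\
  (forall alpha' : R -> {RV P' >-> R},
     brownian_motion0 alpha' ->
     independent_processes alpha' rho' ->
     cvg_in_law P P' (fun t w => 2 / ln t * winding alpha Rt t w)
       (fun w => alpha' (hitting_time rho' 1 w) w)).
Proof.
have [_ cR R_gt1 _] := hR.
have [crho' _] := hrho'.
have mR s : 0 <= s -> measurable_fun setT (Rt s) by [].
have mrho' s : 0 <= s -> measurable_fun setT (rho' s) by [].
have mclock t : measurable_fun setT (clock Rt t) by exact: (measurable_clock mR cR).
have mX t : measurable_fun setT (fun w => 4 / (ln t) ^+ 2 * clock Rt t w).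
  by apply: measurable_funM => //; exact: mclock.
have mhit : measurable_fun setT (hitting_time rho' 1).
  exact: (measurable_hitting mrho' crho').
have hit0 w : 0 <= hitting_time rho' 1 w by apply: inf_ge0 => u [].
split.
  split => // f cf [M fM].
  have mf : measurable_fun setT f by exact: continuous_measurable_fun.
  apply: cvg_pinfty_gt1P => t t1 ty.
  have [Phi [mPhi Phi0 PhiL Phicvg]] := clock_coupling cR R_gt1 hrho hrho' t1 ty.
  have -> : (fun n => \int[P]_w f (4 / (ln (t n)) ^+ 2 * clock Rt (t n) w)) =
            (fun n => \int[P']_w f (Phi n w)).
    by apply/funext => n; apply: (same_law_int (mX (t n)) (mPhi n) mf fM (PhiL n)).
  apply: (@bounded_cvg _ _ _ _ _ _ M) => //.
  - by move=> n; exact: measurableT_comp.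
  - exact: measurableT_comp.
  - by apply: filterS Phicvg => w cw; apply: (@continuous_cvg _ _ _ _ _ _ f) => //; exact: cf.
move=> alpha' balpha' ind'.
have [calpha _ _] := halpha; have [[calpha' _ _] _] := balpha'.
have malpha s : 0 <= s -> measurable_fun setT (alpha s) by [].
have malpha' s : 0 <= s -> measurable_fun setT (alpha' s) by [].
split.
- move=> t; apply: measurable_funM => //.
  by apply: (measurable_at_random_time malpha calpha) => // w; exact: clock_ge0.
- exact: (measurable_at_random_time malpha' calpha').
move=> f cf [M fM].
have mf : measurable_fun setT f by exact: continuous_measurable_fun.
apply: cvg_pinfty_gt1P => t t1 ty.
have [Phi [mPhi Phi0 PhiL Phicvg]] := clock_coupling cR R_gt1 hrho hrho' t1 ty.
pose c n := ln (t n) / 2.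
have c0 n : 0 < c n by rewrite divr_gt0// ln_gt0.
have cy : c n @[n --> \oo] --> +oo.
  apply/cvgryPge => A; near=> n.
  rewrite ler_pdivlMr// -ler_expR lnK ?posrE ?(lt_trans ltr01)//.
  by near: n; exact: cvgry_ge.
(* G n h is the expectation of f (alpha / c) at the frozen time c^2 h *)
pose G n (u : R) := \int[P]_w \int[P']_w' f ((c n)^-1 * alpha 0 w + alpha' (Num.max 0 u) w').
have [mG GM] : (forall n, measurable_fun setT (G n)) /\ (forall n u, `|G n u| <= M).
  by split=> n; have [] := brownian_split_regular (P := P) alpha balpha' (c n)^-1 mf fM.
have cE n : 2 / ln (t n) = (c n)^-1 by rewrite /c invfM invrK mulrC.
have lE n w : clock Rt (t n) w = c n ^+ 2 * (4 / (ln (t n)) ^+ 2 * clock Rt (t n) w).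
  rewrite mulrA [c n ^+ 2 * _](_ : _ = 1) ?mul1r//.
  by rewrite /c; field; rewrite gt_eqF// ln_gt0.
have step n : \int[P]_w f (2 / ln (t n) * winding alpha Rt (t n) w) =
    \int[P']_w G n (Phi n w).
  rewrite -(same_law_int (mX (t n)) (mPhi n) (mG n) (GM n) (PhiL n)).
  rewrite cE /winding.
  have mtau : measurable_fun setT (clock Rt (t n) : history Rt -> R).
    exact: (@measurable_clock _ (history Rt) R (fun s => Rt s) (@history_measurable _ _ _ _ Rt) cR).
  have mfc : measurable_fun setT (fun x => f ((c n)^-1 * x)).
    by apply: measurableT_comp mf _; exact: measurable_funM.
  rewrite (expectation_independent_time calpha hind mtau
    (fun w => clock_ge0 Rt (t n) w) mfc (fun x => fM _)).
  apply: eq_Rintegral => w _.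
  have u0 : 0 <= 4 / (ln (t n)) ^+ 2 * clock Rt (t n) w.
    by rewrite mulr_ge0 ?divr_ge0 ?sqr_ge0// clock_ge0.
  rewrite {1}lE (expectation_brownian_split halpha balpha' (c0 n) u0 mf fM).
  by rewrite /G (max_idPr u0).
have -> : (fun n => \int[P]_w f (2 / ln (t n) * winding alpha Rt (t n) w)) =
   (fun n => \int[P']_w G n (Phi n w)) by apply/funext.
have mhit' : measurable_fun setT (hitting_time rho' 1 : history rho' -> R).
  exact: (@measurable_hitting _ (history rho') R (fun s => rho' s) (@history_measurable _ _ _ _ rho') crho').
rewrite (expectation_independent_time calpha' ind' mhit' hit0 mf fM).
apply: (@bounded_cvg _ _ _ P' _ _ M).
- by move=> n; exact: measurableT_comp (mG n) (mPhi n).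
- have mF : measurable_fun setT (fun p : T' * T' => f (alpha' (hitting_time rho' 1 p.2) p.1)).
    have mj := @measurable_joint _ T' R (fun t => alpha' t) malpha' calpha'.
    have mp : measurable_fun setT (fun p : T' * T' => (hitting_time rho' 1 p.2, p.1) : R * T').
      apply: measurable_fun_pair; last exact: measurable_fst.
      exact: (measurableT_comp mhit measurable_snd).
    apply: measurableT_comp => //.
    apply: eq_measurable_fun (measurableT_comp mj mp) => p _ /=.
    by rewrite (max_idPr (hit0 p.2)).
  exact: (@measurable_fun_mix _ T' _ T' R P' _ M mF).
- by move=> n w; exact: GM.
- apply: filterS Phicvg => w cw.
  have -> : (fun n => G n (Phi n w)) =
    (fun n => \int[P]_w0 \int[P']_w' f ((c n)^-1 * alpha 0 w0 + alpha' (Phi n w) w')).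
    by apply/funext => n; rewrite /G (max_idPr (Phi0 n w)).
  exact: (@expectation_brownian_split_cvg _ _ _ _ _ P P' alpha alpha' balpha' c (Phi ^~ w) _ M f).
Unshelve. all: by end_near. Qed.
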